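(* Let $\mathcal{K}$ be a separable complex Hilbert space and let $1\le p<\infty$, $p\neq2$. Let $\mathcal{C}=\{P_0,P_1,P_2\}$ be a family of generalized tri-circular projections on $S^p_{\mathcal{K}}$, let $\lambda_1,\lambda_2\in\mathbb{T}\setminus\{1\}$ be distinct scalars such that $T=P_0+\lambda_1P_1+\lambda_2P_2$ is a surjective isometry of $S^p_{\mathcal{K}}$, and let $U,V$ be unitary operators on $\mathcal{K}$ and $\varphi$ a disk automorphism such that $$T(f)(z)=Vf(0)+U\int_0^z[\varphi'(\xi)]^{\frac1p}f'(\varphi(\xi))\,d\xi,\qquad f\in S^p_{\mathcal{K}},\ z\in\mathbb{D}.$$ Then one of the following holds: (1) $\varphi(z)=z$ for all $z\in\mathbb{D}$, and $\mathcal{C}$ is a family of tri-circular projections; moreover, the point spectrum of $U$ and $V$ is $\sigma_p=\{1,\lambda_1,\lambda_2\}$. (2) $\varphi$ is not the identity map, $\varphi^2(z)=z$ for all $z\in\mathbb{D}$, and one of the members of $\mathcal{C}$ is a generalized bi-circular projection. (3) $\varphi$ is not the identity map, $\varphi^2$ is not the identity map, $\varphi^3(z)=z$ for all $z\in\mathbb{D}$, $\lambda_1$ and $\lambda_2$ are cube roots of unity, and $U^3=V^3=I_{\mathcal{K}}$, where $I_{\mathcal{K}}$ is the identity operator on $\mathcal{K}$.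
   Context: $\mathbb{D}$ is the open unit disk in $\mathbb{C}$ and $\mathbb{T}$ is the unit circle. $\varphi^n$ denotes the $n$-fold composition of $\varphi$ with itself; $[\varphi']^{1/p}$ denotes an analytic branch on $\mathbb{D}$ of the $1/p$-th power of the zero-free function $\varphi'$. $H^p(\mathcal{K})$ is the Hardy space of $\mathcal{K}$-valued analytic functions on $\mathbb{D}$, with norm $\|\cdot\|_p$. $S^p_{\mathcal{K}}$ is the Banach space of all analytic functions $f:\mathbb{D}\to\mathcal{K}$ such that $f'\in H^p(\mathcal{K})$, with norm $\|f\|=|f(0)|+\|f'\|_p$, where $|\cdot|$ is the norm of $\mathcal{K}$. Known fact (Hornor–Jamison): for $p\neq2$, every linear isometry $T$ of $S^p_{\mathcal{K}}$ onto itself has the displayed form for some unitary operators $U,V$ on $\mathcal{K}$ and some disk automorphism $\varphi$. A projection on a Banach space $X$ is a bounded linear operator $P$ with $P^2=P$. A projection $P$ on $X$ is a generalized bi-circular projection if there is $\lambda\in\mathbb{T}\setminus\{1\}$ such that $P+\lambda(I-P)$ is a surjective isometry on $X$, where $I$ is the identity operator. A collection $\mathcal{C}=\{P_0,P_1,P_2\}$ of nonzero distinct projections on $X$ with $P_0+P_1+P_2=I$ and $P_iP_j=0$ for $i\neq j$ is called: a family of generalized tri-circular projections if there exist distinct $\lambda_1,\lambda_2\in\mathbb{T}\setminus\{1\}$ such that $T=P_0+\lambda_1P_1+\lambda_2P_2$ is a surjective isometry on $X$; and a family of tri-circular projections if $P_0+\lambda_1P_1+\lambda_2P_2$ is a surjective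 isometry on $X$ for all $\lambda_1,\lambda_2\in\mathbb{T}$.
   Formalization: In (3), U^3=I is replaced by [(φ^3)']^{1/p}U^3=I, with the branch induced by T^3 (U^3=I fails for p=3, φ a rotation of order 3); in (1), the point spectrum is the union of those of [φ']^{1/p}U and V, where [φ']^{1/p} is a constant branch of 1^{1/p}. *)

(* Defs.v *)
From Stdlib Require Import Reals Lra Lia FunctionalExtensionality ProofIrrelevance.
From Coquelicot Require Import Coquelicot.
Open Scope R_scope.

(* Real power with [rpow 0 p = 0]; the library's [Rpower 0 p] is [1]. *)
Definition rpow (x p : R) : R := if Rle_dec x 0 then 0 else Rpower x p.

Lemma rpow_0 p : rpow 0 p = 0.
Proof. unfold rpow; destruct (Rle_dec 0 0); lra. Qed.

Lemma rpow_pos_eq x p : 0 < x -> rpow x p = Rpower x p.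
Proof. intros; unfold rpow; destruct (Rle_dec x 0); lra. Qed.

Lemma rpow_gt0 x p : 0 < x -> 0 < rpow x p.
Proof. intros; rewrite rpow_pos_eq by lra. apply exp_pos. Qed.

Lemma rpow_ge0 x p : 0 <= rpow x p.
Proof.
  unfold rpow; destruct (Rle_dec x 0); [lra|]. left; apply exp_pos.
Qed.

Lemma rpow_eq0 x p : 0 <= x -> rpow x p = 0 -> x = 0.
Proof.
  intros [Hx|Hx] H; [|easy]. pose proof (rpow_gt0 x p Hx); lra.
Qed.

Lemma rpow_mult x y p : 0 <= x -> 0 <= y -> rpow (x * y) p = rpow x p * rpow y p.
Proof.
  intros [Hx| <-] [Hy| <-]; rewrite ?Rmult_0_l, ?Rmult_0_r, ?rpow_0; try ring.
  rewrite !rpow_pos_eq; auto using Rmult_lt_0_compat.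
  now rewrite Rpower_mult_distr.
Qed.

Lemma rpow_rpow x p q : p * q = 1 -> 0 <= x -> rpow (rpow x p) q = x.
Proof.
  intros Hpq [Hx| <-]; [|now rewrite !rpow_0].
  rewrite (rpow_pos_eq _ q), rpow_pos_eq; auto using rpow_gt0.
  now rewrite Rpower_mult, Hpq, Rpower_1.
Qed.

Lemma rpow_le x y p : 0 < p -> 0 <= x -> x <= y -> rpow x p <= rpow y p.
Proof.
  intros Hp [Hx| <-] Hxy; [|rewrite rpow_0; apply rpow_ge0].
  rewrite !rpow_pos_eq by lra. apply Rle_Rpower_l; lra.
Qed.

Lemma rpow_lt x y p : 0 < p -> 0 <= x -> x < y -> rpow x p < rpow y p.
Proof.
  intros Hp [Hx| <-] Hxy; [|rewrite rpow_0; apply rpow_gt0; lra].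
  rewrite !rpow_pos_eq by lra. unfold Rpower. apply exp_increasing.
  apply Rmult_lt_compat_l; auto. apply ln_increasing; lra.
Qed.

Lemma rpow_continuous p x : 0 < p -> continuous (fun y : R => rpow y p) x.
Proof.
  intros Hp. destruct (Rtotal_order x 0) as [Hx|[->|Hx]].
  - apply continuous_ext_loc with (fun _ => 0); [|apply continuous_const].
    exists (mkposreal (-x) ltac:(lra)). intros y Hy.
    unfold ball in Hy; simpl in Hy; unfold AbsRing_ball, abs, minus, plus, opp in Hy; simpl in Hy.
    apply Rabs_def2 in Hy. unfold rpow. destruct (Rle_dec y 0); lra.
  - intros P. rewrite rpow_0. intros [eps Heps].
    assert (He : 0 < rpow eps (/p)) by (apply rpow_gt0, eps).
    exists (mkposreal _ He). intros y Hy. apply Heps.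
    unfold ball in *; simpl in *; unfold AbsRing_ball, abs, minus, plus, opp in *; simpl in *.
    rewrite Ropp_0, Rplus_0_r in *. rewrite (Rabs_pos_eq (rpow y p)) by apply rpow_ge0.
    apply Rabs_def2 in Hy. destruct (Rle_dec y 0).
    + unfold rpow; destruct (Rle_dec y 0); [apply eps|lra].
    + replace (pos eps) with (rpow (rpow eps (/p)) p).
      * apply rpow_lt; lra.
      * apply rpow_rpow; [field; lra|left; apply eps].
  - apply continuous_ext_loc with (fun y => exp (p * ln y)).
    + exists (mkposreal x Hx). intros y Hy.
      unfold ball in Hy; simpl in Hy; unfold AbsRing_ball, abs, minus, plus, opp in Hy; simpl in Hy.
      apply Rabs_def2 in Hy. unfold rpow. destruct (Rle_dec y 0); [lra|reflexivity].
    + apply (ex_derive_continuous (fun y => exp (p * ln y))). auto_derive. auto.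
Qed.

Lemma rpow_bernoulli t p : 1 <= p -> 0 <= t -> 1 + p * (t - 1) <= rpow t p.
Proof.
  intros Hp [Ht| <-]; [|rewrite rpow_0; lra].
  rewrite rpow_pos_eq by easy.
  assert (H1 : Rpower t p = t * exp ((p - 1) * ln t)).
  { unfold Rpower. rewrite <- (exp_ln t) at 2 by easy. rewrite <- exp_plus. f_equal; ring. }
  rewrite H1.
  assert (H2 : 1 + (p - 1) * ln t <= exp ((p - 1) * ln t)).
  { destruct (Req_dec ((p - 1) * ln t) 0) as [E|E].
    - rewrite E, exp_0; lra.
    - left. now apply exp_ineq1. }
  assert (H3 : t - 1 <= t * ln t).
  { destruct (Req_dec (ln t) 0) as [E|E].
    - rewrite E. rewrite <- (exp_ln t), E, exp_0 by easy; lra.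
    - pose proof (exp_ineq1 (- ln t) ltac:(lra)) as H.
      rewrite exp_Ropp, exp_ln in H by easy.
      apply (Rmult_lt_compat_l t) in H; [|easy].
      rewrite Rinv_r in H by lra. lra. }
  apply Rle_trans with (t * (1 + (p - 1) * ln t)); [|apply Rmult_le_compat_l; lra].
  nra.
Qed.

Lemma rpow_convex p a x y : 1 <= p -> 0 < a < 1 -> 0 <= x -> 0 <= y ->
  rpow (a * x + (1 - a) * y) p <= a * rpow x p + (1 - a) * rpow y p.
Proof.
  intros Hp Ha Hx Hy. set (z := a * x + (1 - a) * y).
  assert (Hz : 0 <= z) by (unfold z; nra).
  destruct Hz as [Hz|Hz].
  2:{ rewrite <- Hz, rpow_0. pose proof (rpow_ge0 x p); pose proof (rpow_ge0 y p); nra. }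
  assert (H : forall u, 0 <= u -> rpow z p * (1 + p * (u / z - 1)) <= rpow u p).
  { intros u Hu. replace (rpow u p) with (rpow z p * rpow (u / z) p).
    - apply Rmult_le_compat_l; [apply rpow_ge0|]. apply rpow_bernoulli; auto.
      apply Rdiv_le_0_compat; lra.
    - rewrite <- rpow_mult; [f_equal; field; lra|lra|apply Rdiv_le_0_compat; lra]. }
  pose proof (H x Hx) as Hx'. pose proof (H y Hy) as Hy'.
  apply Rle_trans with (a * (rpow z p * (1 + p * (x / z - 1))) + (1 - a) * (rpow z p * (1 + p * (y / z - 1)))).
  - right. transitivity (rpow z p * (1 + p * ((a * x + (1 - a) * y) / z - 1))).
    + fold z. field. lra.
    + field. lra.
  - nra.
Qed.

Definition circle_norm (p : R) (u : R -> R) : R :=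
  rpow (/ (2 * PI) * RInt (fun t => rpow (u t) p) 0 (2 * PI)) (/ p).

Lemma two_pi_pos : 0 < 2 * PI.
Proof. pose proof PI_RGT_0; lra. Qed.

Lemma ex_RInt_rpow p u : 0 < p -> (forall t, continuous u t) ->
  ex_RInt (fun t => rpow (u t) p) 0 (2 * PI).
Proof.
  intros Hp Hu. apply (ex_RInt_continuous (fun t : R => rpow (u t) p)). intros t _.
  apply (continuous_comp u (fun y => rpow y p)); [apply Hu|now apply rpow_continuous].
Qed.

Lemma circle_norm_ge0 p u : 0 <= circle_norm p u.
Proof. apply rpow_ge0. Qed.

Lemma RInt_rpow_ge0 p u : 0 < p -> (forall t, continuous u t) ->
  0 <= / (2 * PI) * RInt (fun t => rpow (u t) p) 0 (2 * PI).
Proof.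
  intros Hp Hu. pose proof two_pi_pos. apply Rmult_le_pos.
  - left. now apply Rinv_0_lt_compat.
  - apply RInt_ge_0; [lra|now apply ex_RInt_rpow|]. intros; apply rpow_ge0.
Qed.

Lemma rpow_circle_norm p u : 0 < p -> (forall t, continuous u t) ->
  rpow (circle_norm p u) p = / (2 * PI) * RInt (fun t => rpow (u t) p) 0 (2 * PI).
Proof.
  intros Hp Hu. unfold circle_norm. apply rpow_rpow; [field; lra|now apply RInt_rpow_ge0].
Qed.

Lemma circle_norm_le_of p u A : 0 < p -> 0 <= A -> (forall t, continuous u t) ->
  / (2 * PI) * RInt (fun t => rpow (u t) p) 0 (2 * PI) <= rpow A p -> circle_norm p u <= A.
Proof.
  intros Hp HA Hu H. rewrite <- (rpow_rpow A p (/ p)); [|field; lra|easy].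
  apply rpow_le; [now apply Rinv_0_lt_compat|now apply RInt_rpow_ge0|easy].
Qed.

Lemma circle_norm_le p u v : 0 < p ->
  (forall t, continuous u t) -> (forall t, continuous v t) ->
  (forall t, 0 <= u t) -> (forall t, u t <= v t) -> circle_norm p u <= circle_norm p v.
Proof.
  intros Hp Hu Hv Hu0 Huv. pose proof two_pi_pos.
  apply circle_norm_le_of; auto using circle_norm_ge0.
  rewrite rpow_circle_norm by easy. apply Rmult_le_compat_l.
  - left. now apply Rinv_0_lt_compat.
  - apply RInt_le; [lra|now apply ex_RInt_rpow|now apply ex_RInt_rpow|].
    intros; apply rpow_le; auto.
Qed.

Lemma circle_norm_scal p u a : 0 < p -> 0 <= a -> (forall t, continuous u t) ->
  (forall t, 0 <= u t) -> circle_norm p (fun t => a * u t) = a * circle_norm p u.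
Proof.
  intros Hp Ha Hu Hu0. unfold circle_norm.
  rewrite (RInt_ext _ (fun t => scal (rpow a p) (rpow (u t) p))).
  2:{ intros t _. unfold scal; simpl; unfold mult; simpl. now apply rpow_mult. }
  rewrite (RInt_scal (V := R_CompleteNormedModule) (fun t => rpow (u t) p)) by now apply ex_RInt_rpow.
  unfold scal; simpl; unfold mult; simpl.
  rewrite <- Rmult_assoc, (Rmult_comm (/ _)), Rmult_assoc.
  rewrite rpow_mult, rpow_rpow; auto using rpow_ge0, RInt_rpow_ge0. field; lra.
Qed.

Lemma circle_norm_plus_aux p u v A B : 1 <= p -> 0 < A -> 0 < B ->
  (forall t, continuous u t) -> (forall t, continuous v t) ->
  (forall t, 0 <= u t) -> (forall t, 0 <= v t) ->
  circle_norm p u <= A -> circle_norm p v <= B ->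
  circle_norm p (fun t => u t + v t) <= A + B.
Proof.
  intros Hp HA HB Hu Hv Hu0 Hv0 HuA HvB. pose proof two_pi_pos.
  assert (Hc : forall t, continuous (fun t => u t + v t) t)
    by (intros t; apply (continuous_plus u v); auto).
  set (a := A / (A + B)).
  assert (Ha : 0 < a < 1).
  { unfold a. split; [apply Rdiv_lt_0_compat; lra|].
    apply Rmult_lt_reg_r with (A + B); [lra|]. field_simplify; lra. }
  assert (HAB : 0 < rpow (A + B) p) by (apply rpow_gt0; lra).
  assert (K : forall (w : R -> R) (C : R), 0 < C -> (forall t, continuous w t) -> (forall t, 0 <= w t) ->
    circle_norm p w <= C ->
    / (2 * PI) * RInt (fun t => rpow (/ C * w t) p) 0 (2 * PI) <= 1).
  { intros w C HC Hw Hw0 HwC.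
    assert (HC' : 0 < / C) by now apply Rinv_0_lt_compat.
    rewrite <- (rpow_circle_norm p (fun t => / C * w t)); [|lra|].
    2:{ intros t. apply (continuous_scal_r (/ C) w). apply Hw. }
    rewrite circle_norm_scal; auto; try lra.
    replace 1 with (rpow 1 p) by (rewrite rpow_pos_eq by lra; unfold Rpower; rewrite ln_1, Rmult_0_r; apply exp_0).
    apply rpow_le; [lra|apply Rmult_le_pos; [lra|apply circle_norm_ge0]|].
    rewrite <- (Rinv_l C) by lra. apply Rmult_le_compat_l; lra. }
  assert (C1 : forall (w : R -> R) (C : R), (forall t, continuous w t) -> forall t, continuous (fun t => / C * w t) t)
    by (intros w C Hw t; apply (continuous_scal_r (/ C) w); apply Hw).
  apply circle_norm_le_of; auto; try lra.
  assert (E1 : ex_RInt (fun t => rpow (/ A * u t) p) 0 (2 * PI)) by (apply (ex_RInt_rpow p (fun t => / A * u t)); [lra|now apply C1]).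
  assert (E2 : ex_RInt (fun t => rpow (/ B * v t) p) 0 (2 * PI)) by (apply (ex_RInt_rpow p (fun t => / B * v t)); [lra|now apply C1]).
  assert (E3 : ex_RInt (fun t => plus (scal a (rpow (/ A * u t) p)) (scal (1 - a) (rpow (/ B * v t) p))) 0 (2 * PI)).
  { apply (ex_RInt_plus (V := R_NormedModule)); now apply (ex_RInt_scal (V := R_NormedModule)). }
  assert (L : RInt (fun t => rpow (u t + v t) p) 0 (2 * PI) <=
    RInt (fun t => scal (rpow (A + B) p) (plus (scal a (rpow (/ A * u t) p)) (scal (1 - a) (rpow (/ B * v t) p)))) 0 (2 * PI)).
  { apply RInt_le; [lra|apply ex_RInt_rpow; auto; lra|now apply (ex_RInt_scal (V := R_NormedModule))|].
    intros t _. unfold scal, plus; simpl; unfold mult; simpl.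
    assert (HA' : 0 < / A) by now apply Rinv_0_lt_compat.
    assert (HB' : 0 < / B) by now apply Rinv_0_lt_compat.
    assert (P1 : 0 <= / A * u t) by (apply Rmult_le_pos; [lra|auto]).
    assert (P2 : 0 <= / B * v t) by (apply Rmult_le_pos; [lra|auto]).
    replace (u t + v t) with ((A + B) * (a * (/ A * u t) + (1 - a) * (/ B * v t))) by (unfold a; field; lra).
    rewrite rpow_mult by nra.
    apply Rmult_le_compat_l; [lra|]. now apply rpow_convex. }
  rewrite (RInt_scal (V := R_CompleteNormedModule)
    (fun t => plus (scal a (rpow (/ A * u t) p)) (scal (1 - a) (rpow (/ B * v t) p)))) in L by easy.
  rewrite (RInt_plus (V := R_CompleteNormedModule) (fun t => scal a (rpow (/ A * u t) p))
    (fun t => scal (1 - a) (rpow (/ B * v t) p))) in L by now apply (ex_RInt_scal (V := R_NormedModule)).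
  rewrite (RInt_scal (V := R_CompleteNormedModule) (fun t => rpow (/ A * u t) p)) in L by easy.
  rewrite (RInt_scal (V := R_CompleteNormedModule) (fun t => rpow (/ B * v t) p)) in L by easy.
  unfold scal, plus in L; simpl in L; unfold mult in L; simpl in L.
  pose proof (K u A HA Hu Hu0 HuA) as Ku. pose proof (K v B HB Hv Hv0 HvB) as Kv.
  assert (Hpi : 0 < / (2 * PI)) by now apply Rinv_0_lt_compat.
  apply (Rmult_le_compat_l (/ (2 * PI))) in L; [|lra].
  eapply Rle_trans; [exact L|].
  set (I1 := RInt (fun t => rpow (/ A * u t) p) 0 (2 * PI)) in *.
  set (I2 := RInt (fun t => rpow (/ B * v t) p) 0 (2 * PI)) in *.
  replace (/ (2 * PI) * (rpow (A + B) p * (a * I1 + (1 - a) * I2))) with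
    (rpow (A + B) p * (a * (/ (2 * PI) * I1) + (1 - a) * (/ (2 * PI) * I2))) by ring.
  rewrite <- (Rmult_1_r (rpow (A + B) p)) at 2. apply Rmult_le_compat_l; [lra|]. nra.
Qed.

Lemma circle_norm_plus p u v : 1 <= p ->
  (forall t, continuous u t) -> (forall t, continuous v t) ->
  (forall t, 0 <= u t) -> (forall t, 0 <= v t) ->
  circle_norm p (fun t => u t + v t) <= circle_norm p u + circle_norm p v.
Proof.
  intros Hp Hu Hv Hu0 Hv0. apply le_epsilon. intros e He.
  replace (circle_norm p u + circle_norm p v + e) with
    ((circle_norm p u + e / 2) + (circle_norm p v + e / 2)) by field.
  pose proof (circle_norm_ge0 p u). pose proof (circle_norm_ge0 p v).
  apply circle_norm_plus_aux; auto; lra.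
Qed.

Lemma RInt_cont_eq0 u a b t0 : (forall t, continuous u t) -> (forall t, 0 <= u t) ->
  a <= t0 < b -> RInt u a b = 0 -> u t0 = 0.
Proof.
  intros Hu Hu0 Ht HI. destruct (Hu0 t0) as [Hpos|E]; [exfalso|easy].
  assert (Hl : locally (u t0) (fun y => u t0 / 2 < y)).
  { apply open_gt. lra. }
  destruct (Hu t0 _ Hl) as [d Hd].
  set (c := Rmin b (t0 + d / 2)).
  pose proof (cond_pos d) as Hdp.
  assert (Hc : t0 < c <= b /\ c <= t0 + d / 2).
  { unfold c. split; [split; [apply Rmin_glb_lt; lra|apply Rmin_l]|apply Rmin_r]. }
  assert (E : forall x y, ex_RInt u x y) by (intros; apply (ex_RInt_continuous u); auto).
  rewrite <- (RInt_Chasles u a t0 b), <- (RInt_Chasles u t0 c b) in HI by apply E.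
  unfold plus in HI; simpl in HI.
  assert (0 <= RInt u a t0) by (apply RInt_ge_0; auto; lra).
  assert (0 <= RInt u c b) by (apply RInt_ge_0; auto; lra).
  assert (0 < RInt u t0 c).
  { apply Rlt_le_trans with (RInt (fun _ => u t0 / 2) t0 c).
    - rewrite RInt_const. unfold scal; simpl; unfold mult; simpl. nra.
    - apply RInt_le; auto; [lra|apply ex_RInt_const|]. intros x Hx. left. apply Hd.
      unfold ball; simpl; unfold AbsRing_ball, abs, minus, plus, opp; simpl.
      apply Rabs_def1; lra. }
  lra.
Qed.

Lemma circle_norm_eq0 p u t0 : 0 < p -> (forall t, continuous u t) -> (forall t, 0 <= u t) ->
  0 <= t0 < 2 * PI -> circle_norm p u = 0 -> u t0 = 0.
Proof.
  intros Hp Hu Hu0 Ht H. pose proof two_pi_pos.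
  assert (H' := rpow_circle_norm p u Hp Hu). rewrite H, rpow_0 in H'.
  apply rpow_eq0 with p; auto.
  apply (RInt_cont_eq0 (fun t => rpow (u t) p) 0 (2 * PI)); auto using rpow_ge0.
  - intros t. apply (continuous_comp u (fun y => rpow y p)); [apply Hu|now apply rpow_continuous].
  - symmetry in H'. apply Rmult_integral in H'. destruct H' as [H'|]; auto.
    pose proof (Rinv_0_lt_compat (2 * PI)). lra.
Qed.
Section Scalars_real.
Context (K : CompleteNormedModule C_AbsRing).

Definition real_scal (a : R) (x : K) : K := scal (RtoC a : C_AbsRing) x.

Lemma real_scal_assoc (a b : R) (x : K) : real_scal a (real_scal b x) = real_scal (mult a b) x.
Proof.
  unfold real_scal. transitivity (scal (mult (RtoC a : C_AbsRing) (RtoC b)) x).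
  - exact (@scal_assoc C_Ring K (RtoC a) (RtoC b) x).
  - f_equal. symmetry. exact (RtoC_mult a b).
Qed.
Lemma real_scal_one (x : K) : real_scal one x = x.
Proof. exact (scal_one x). Qed.
Lemma real_scal_plus_l (a : R) (x y : K) : real_scal a (plus x y) = plus (real_scal a x) (real_scal a y).
Proof. exact (@scal_distr_l C_Ring K (RtoC a) x y). Qed.
Lemma real_scal_plus_r (a b : R) (x : K) : real_scal (plus a b) x = plus (real_scal a x) (real_scal b x).
Proof.
  unfold real_scal. transitivity (scal (plus (RtoC a : C_AbsRing) (RtoC b)) x).
  - f_equal. exact (RtoC_plus a b).
  - exact (@scal_distr_r C_Ring K (RtoC a) (RtoC b) x).
Qed.

Definition realify_module_mixin : ModuleSpace.mixin_of R_Ring K :=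
  ModuleSpace.Mixin R_Ring K real_scal
    real_scal_assoc real_scal_one real_scal_plus_l real_scal_plus_r.

Definition realify_aux : NormedModuleAux R_AbsRing :=
  NormedModuleAux.Pack R_AbsRing K
    (NormedModuleAux.Class R_AbsRing K
      (ModuleSpace.Class R_Ring K (AbelianGroup.class K) realify_module_mixin)
      (UniformSpace.class K)) K.

Lemma real_scal_norm (a : R) (x : K) : norm (real_scal a x) <= abs a * norm x.
Proof.
  unfold real_scal. eapply Rle_trans; [apply (@norm_scal C_AbsRing K)|].
  right. f_equal. apply Cmod_R.
Qed.

Definition realify_normed_mixin : NormedModule.mixin_of R_AbsRing realify_aux :=
  NormedModule.Mixin R_AbsRing realify_aux norm (@norm_factor C_AbsRing K)
    norm_triangle real_scal_norm norm_compat1 norm_compat2 norm_eq_zero.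

(* [K] with scalars restricted to [R]: same carrier, norm and uniform structure. *)
Definition realify : CompleteNormedModule R_AbsRing :=
  CompleteNormedModule.Pack R_AbsRing K
    (CompleteNormedModule.Class R_AbsRing K
      (NormedModule.Class R_AbsRing K
        (NormedModuleAux.class R_AbsRing realify_aux) realify_normed_mixin)
      (CompleteSpace.class K)) K.

End Scalars_real.

Section Analytic.
Context {V : NormedModule C_AbsRing}.

Definition analytic (f : C -> V) : Prop :=
  forall z, Cmod z < 1 -> ex_derive (K := C_AbsRing) (V := V) f z.

Lemma locally_disk (z : C) : Cmod z < 1 ->
  locally (T := AbsRing_UniformSpace C_AbsRing) z (fun w => Cmod w < 1).
Proof.
  intros Hz. exists (mkposreal (1 - Cmod z) ltac:(lra)). intros w Hw.
  unfold ball in Hw; simpl in Hw; unfold AbsRing_ball, abs in Hw; simpl in Hw.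
  replace w with (Cplus z (minus w z : C)).
  - eapply Rle_lt_trans; [apply Cmod_triangle|]. lra.
  - unfold minus, plus, opp; simpl. ring.
Qed.

Lemma is_derive_C_zero (f : C -> V) z l :
  (forall w, f w = zero) -> is_derive (K := C_AbsRing) f z l -> l = zero.
Proof.
  intros Hf [_ H]. apply norm_eq_zero. apply Rle_antisym; [|apply norm_ge_0].
  apply le_epsilon. intros e He. rewrite Rplus_0_l.
  destruct (H z (fun P HP => HP) (mkposreal e He)) as [d Hd].
  set (h := RtoC (d / 2)). pose proof (cond_pos d) as Hdp.
  assert (Hh : Cmod h = d / 2) by (unfold h; rewrite Cmod_R; apply Rabs_pos_eq; lra).
  assert (Hyz : minus (Cplus z h : C_AbsRing) z = h) by (unfold minus, plus, opp; simpl; ring).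
  assert (B : ball (M := AbsRing_UniformSpace C_AbsRing) z d (Cplus z h)).
  { unfold ball; simpl; unfold AbsRing_ball. rewrite Hyz. change (Cmod h < d). lra. }
  assert (Hd' : norm (minus (minus (f (Cplus z h)) (f z)) (scal (h : C_AbsRing) l)) <= e * Cmod h).
  { rewrite <- Hyz at 2 3. exact (Hd _ B). }
  clear Hd. rename Hd' into Hd. rewrite !Hf in Hd.
  rewrite minus_eq_zero in Hd. unfold minus in Hd. rewrite plus_zero_l, norm_opp in Hd.
  assert (Hh0 : h <> RtoC 0) by (intros E; rewrite E, Cmod_0 in Hh; lra).
  replace l with (scal (/ h : C_AbsRing)%C (scal (h : C_AbsRing) l)).
  2:{ rewrite scal_assoc. replace (mult (/ h : C_AbsRing)%C (h : C_AbsRing)) with (one : C_AbsRing); [apply scal_one|].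
      unfold mult, one; simpl. symmetry. now apply Cinv_l. }
  eapply Rle_trans; [apply (@norm_scal C_AbsRing V)|].
  change (abs (K := C_AbsRing) (/ h)%C) with (Cmod (/ h)).
  rewrite Cmod_inv, Hh by easy. rewrite Hh in Hd.
  apply Rle_trans with (/ (d / 2) * (e * (d / 2))).
  - apply Rmult_le_compat_l; [|exact Hd]. left. apply Rinv_0_lt_compat; lra.
  - right. field. lra.
Qed.

Lemma is_derive_C_unique (f : C -> V) z l1 l2 :
  is_derive (K := C_AbsRing) f z l1 -> is_derive (K := C_AbsRing) f z l2 -> l1 = l2.
Proof.
  intros H1 H2. pose proof (is_derive_minus _ _ _ _ _ H1 H2) as H.
  apply is_derive_C_zero in H; [|intros w; exact (@minus_eq_zero V (f w))].
  apply (@plus_reg_r V (opp l2)). transitivity (@zero V); [exact H|].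
  symmetry. exact (@plus_opp_r V l2).
Qed.

Lemma norm_scal_C (a : C) (x : V) : norm (scal (a : C_AbsRing) x) = Cmod a * norm x.
Proof.
  apply Rle_antisym; [apply (@norm_scal C_AbsRing V)|].
  destruct (Ceq_dec a (RtoC 0)) as [->|Ha].
  - rewrite Cmod_0, Rmult_0_l. apply norm_ge_0.
  - assert (Hm := proj1 (Cmod_gt_0 a) Ha).
    assert (E : x = scal (/ a : C_AbsRing)%C (scal (a : C_AbsRing) x)).
    { rewrite scal_assoc. replace (mult (/ a : C_AbsRing)%C (a : C_AbsRing)) with (one : C_AbsRing); [now rewrite scal_one|].
      unfold mult, one; simpl. symmetry. now apply Cinv_l. }
    rewrite E at 1. apply Rmult_le_reg_l with (/ Cmod a); [now apply Rinv_0_lt_compat|].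
    rewrite <- Rmult_assoc, Rinv_l, Rmult_1_l by lra.
    rewrite <- Cmod_inv by easy. apply (@norm_scal C_AbsRing V).
Qed.

Lemma analytic_ext (f g : C -> V) :
  (forall z, Cmod z < 1 -> f z = g z) -> analytic f -> analytic g.
Proof.
  intros E Hf z Hz. eapply ex_derive_ext_loc; [|now apply Hf].
  eapply filter_imp; [|now apply locally_disk]. exact E.
Qed.

Lemma analytic_plus (f g : C -> V) :
  analytic f -> analytic g -> analytic (fun z => plus (f z) (g z)).
Proof. intros Hf Hg z Hz. apply (ex_derive_plus f g); auto. Qed.

Lemma analytic_opp (f : C -> V) : analytic f -> analytic (fun z => opp (f z)).
Proof. intros Hf z Hz. apply (ex_derive_opp f); auto. Qed.

Lemma is_derive_scal_C (a : C) (f : C -> V) z l : is_derive (K := C_AbsRing) f z l ->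
  is_derive (K := C_AbsRing) (fun w => scal (a : C_AbsRing) (f w)) z (scal (a : C_AbsRing) l).
Proof.
  intros H. unfold is_derive in *.
  apply (filterdiff_ext_lin _ (fun y : AbsRing_NormedModule C_AbsRing => scal (a : C_AbsRing) (scal (y : C_AbsRing) l))).
  - apply (@filterdiff_scal_r_fct C_AbsRing (AbsRing_NormedModule C_AbsRing) V); auto.
    + apply locally_filter.
    + exact Cmult_comm.
  - intros y. rewrite !scal_assoc. f_equal. exact (Cmult_comm a y).
Qed.

Lemma analytic_scal (a : C) (f : C -> V) :
  analytic f -> analytic (fun z => scal (a : C_AbsRing) (f z)).
Proof.
  intros Hf z Hz. destruct (Hf z Hz) as [l Hl].
  exists (scal (a : C_AbsRing) l). now apply is_derive_scal_C.
Qed.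

Lemma analytic_zero : analytic (fun _ => zero).
Proof. intros z Hz. apply ex_derive_const. Qed.

Definition on_circle (f : C -> V) (r t : R) : V := f ((r * cos t)%R, (r * sin t)%R).

Lemma Cmod_polar r t : 0 <= r -> Cmod (r * cos t, r * sin t) = r.
Proof.
  intros Hr. unfold Cmod; simpl. pose proof (sin2_cos2 t) as H. unfold Rsqr in H.
  replace (r * cos t * (r * cos t * 1) + r * sin t * (r * sin t * 1)) with (r * r * (sin t * sin t + cos t * cos t)) by ring.
  rewrite H, Rmult_1_r. now apply sqrt_square.
Qed.

Lemma circle_cont r t : continuous (U := AbsRing_UniformSpace C_AbsRing)
  (fun t : R => (r * cos t, r * sin t)) t.
Proof.
  intros P HP. apply locally_C in HP. revert P HP.
  apply (continuous_comp_2 (fun t => r * cos t) (fun t => r * sin t) (fun x y : R => (x, y))).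
  - apply (continuous_scal_r r cos). apply continuous_cos.
  - apply (continuous_scal_r r sin). apply continuous_sin.
  - intros P HP. unfold filtermap. apply (filter_imp P); [|exact HP]. now intros [x y].
Qed.

Lemma on_circle_cont (f : C -> V) r t : 0 <= r < 1 -> analytic f ->
  continuous (fun t => norm (on_circle f r t)) t.
Proof.
  intros Hr Hf.
  apply (continuous_comp (fun t => on_circle f r t) (norm (K := C_AbsRing))); [|apply filterlim_norm].
  apply (continuous_comp (V := AbsRing_UniformSpace C_AbsRing) (fun t : R => (r * cos t, r * sin t)) f).
  - apply circle_cont.
  - apply (ex_derive_continuous f). apply Hf. rewrite Cmod_polar; lra.
Qed.

Definition Hp_mean (p : R) (f : C -> V) (r : R) : R :=
  circle_norm p (fun t => norm (on_circle f r t)).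

Definition Hardy (p : R) (f : C -> V) : Prop :=
  analytic f /\ exists M, forall r, 0 <= r < 1 -> Hp_mean p f r <= M.

Definition Hp_norm (p : R) (f : C -> V) : R :=
  real (Lub_Rbar (fun m => exists r, 0 <= r < 1 /\ m = Hp_mean p f r)).

Lemma Hp_norm_lub p f : Hardy p f ->
  is_lub_Rbar (fun m => exists r, 0 <= r < 1 /\ m = Hp_mean p f r) (Hp_norm p f).
Proof.
  intros [_ [M HM]]. unfold Hp_norm.
  set (E := fun m => exists r, 0 <= r < 1 /\ m = Hp_mean p f r).
  pose proof (Lub_Rbar_correct E) as [H1 H2].
  destruct (Lub_Rbar E) as [x| |] eqn:EL; simpl.
  - now split.
  - assert (H : Rbar_le p_infty M); [|destruct H].
    apply H2. intros m [r [Hr ->]]. now apply HM.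
  - assert (H : Rbar_le (Hp_mean p f 0) m_infty); [|destruct H].
    apply H1. exists 0. split; [lra|easy].
Qed.

Lemma Hp_mean_le_norm p f r : Hardy p f -> 0 <= r < 1 -> Hp_mean p f r <= Hp_norm p f.
Proof. intros Hf Hr. apply (proj1 (Hp_norm_lub p f Hf)). now exists r. Qed.

Lemma Hp_norm_le p f M : Hardy p f -> (forall r, 0 <= r < 1 -> Hp_mean p f r <= M) ->
  Hp_norm p f <= M.
Proof.
  intros Hf HM. apply (proj2 (Hp_norm_lub p f Hf) M). intros m [r [Hr ->]]. now apply HM.
Qed.

Lemma Hp_norm_ge0 p f : Hardy p f -> 0 <= Hp_norm p f.
Proof.
  intros Hf. eapply Rle_trans; [|apply (Hp_mean_le_norm p f 0); auto; lra].
  apply circle_norm_ge0.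
Qed.

Lemma Hp_mean_ext p f g r : (forall z, Cmod z < 1 -> f z = g z) -> 0 <= r < 1 ->
  Hp_mean p f r = Hp_mean p g r.
Proof.
  intros E Hr. unfold Hp_mean. f_equal. apply functional_extensionality. intros t.
  unfold on_circle. rewrite E; auto. rewrite Cmod_polar; lra.
Qed.

Lemma Hardy_ext p f g : (forall z, Cmod z < 1 -> f z = g z) -> Hardy p f -> Hardy p g.
Proof.
  intros E [Hf [M HM]]. split; [now apply analytic_ext with f|].
  exists M. intros r Hr. rewrite <- (Hp_mean_ext p f g); auto.
Qed.

Lemma Hp_norm_ext p f g : (forall z, Cmod z < 1 -> f z = g z) -> Hp_norm p f = Hp_norm p g.
Proof.
  intros E. unfold Hp_norm. f_equal. apply Lub_Rbar_eqset. intros m.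
  split; intros [r [Hr ->]]; exists r; split; auto; [|symmetry]; now apply Hp_mean_ext.
Qed.

Lemma Hp_mean_plus p f g r : 1 <= p -> analytic f -> analytic g -> 0 <= r < 1 ->
  Hp_mean p (fun z => plus (f z) (g z)) r <= Hp_mean p f r + Hp_mean p g r.
Proof.
  intros Hp Hf Hg Hr. unfold Hp_mean.
  eapply Rle_trans; [|apply circle_norm_plus; auto; intros; try apply norm_ge_0; now apply on_circle_cont].
  apply circle_norm_le; [lra| | | |].
  - intros t. now apply (on_circle_cont (fun z => plus (f z) (g z))), analytic_plus.
  - intros t. apply (continuous_plus (fun t => norm (on_circle f r t)) (fun t => norm (on_circle g r t)));
      now apply on_circle_cont.
  - intros; apply norm_ge_0.
  - intros t. apply norm_triangle.
Qed.

Lemma Hp_mean_scal p f r a : 0 < p -> analytic f -> 0 <= r < 1 ->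
  Hp_mean p (fun z => scal (a : C_AbsRing) (f z)) r = Cmod a * Hp_mean p f r.
Proof.
  intros Hp Hf Hr. unfold Hp_mean.
  rewrite <- circle_norm_scal; auto using Cmod_ge_0.
  - f_equal. apply functional_extensionality. intros t. apply norm_scal_C.
  - intros t; now apply on_circle_cont.
  - intros t; apply norm_ge_0.
Qed.

Lemma Hardy_plus p f g : 1 <= p -> Hardy p f -> Hardy p g -> Hardy p (fun z => plus (f z) (g z)).
Proof.
  intros Hp Hf Hg. split; [apply analytic_plus; [apply Hf|apply Hg]|].
  exists (Hp_norm p f + Hp_norm p g). intros r Hr.
  eapply Rle_trans; [apply Hp_mean_plus; auto; [apply Hf|apply Hg]|].
  apply Rplus_le_compat; now apply Hp_mean_le_norm.
Qed.

Lemma Hp_norm_plus p f g : 1 <= p -> Hardy p f -> Hardy p g ->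
  Hp_norm p (fun z => plus (f z) (g z)) <= Hp_norm p f + Hp_norm p g.
Proof.
  intros Hp Hf Hg. apply Hp_norm_le; [now apply Hardy_plus|]. intros r Hr.
  eapply Rle_trans; [apply Hp_mean_plus; auto; [apply Hf|apply Hg]|].
  apply Rplus_le_compat; now apply Hp_mean_le_norm.
Qed.

Lemma Hardy_scal p f a : 0 < p -> Hardy p f -> Hardy p (fun z => scal (a : C_AbsRing) (f z)).
Proof.
  intros Hp Hf. split; [apply analytic_scal, Hf|].
  exists (Cmod a * Hp_norm p f). intros r Hr.
  rewrite Hp_mean_scal; auto; [|apply Hf].
  apply Rmult_le_compat_l; [apply Cmod_ge_0|now apply Hp_mean_le_norm].
Qed.

Lemma Hp_norm_scal_le p f a : 0 < p -> Hardy p f ->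
  Hp_norm p (fun z => scal (a : C_AbsRing) (f z)) <= Cmod a * Hp_norm p f.
Proof.
  intros Hp Hf. apply Hp_norm_le; [now apply Hardy_scal|]. intros r Hr.
  rewrite Hp_mean_scal; auto; [|apply Hf].
  apply Rmult_le_compat_l; [apply Cmod_ge_0|now apply Hp_mean_le_norm].
Qed.

Lemma Hardy_zero p : 0 < p -> Hardy p (fun _ => zero).
Proof.
  intros Hp. split; [apply analytic_zero|]. exists 0. intros r Hr. right.
  unfold Hp_mean. rewrite <- (Rmult_0_l (circle_norm p (fun _ => norm (zero : V)))).
  rewrite <- circle_norm_scal; auto; try lra.
  - f_equal. apply functional_extensionality. intros t. unfold on_circle. rewrite norm_zero; ring.
  - intros; apply continuous_const.
  - intros; apply norm_ge_0.
Qed.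

Lemma polar_form (z : C) : Cmod z = 1 -> exists t, 0 <= t < 2 * PI /\ z = (cos t, sin t).
Proof.
  destruct z as [x y]. unfold Cmod; simpl. intros H.
  assert (H1 : x * x + y * y = 1).
  { apply (f_equal Rsqr) in H. rewrite Rsqr_sqrt in H by nra. unfold Rsqr in H. lra. }
  assert (Hx : -1 <= x <= 1) by nra.
  pose proof (acos_bound x) as Hb. pose proof PI_RGT_0.
  assert (S : sin (acos x) = Rabs y).
  { rewrite sin_acos by easy. replace (1 - Rsqr x) with (Rsqr y) by (unfold Rsqr; lra).
    apply sqrt_Rsqr_abs. }
  destruct (Rle_dec 0 y) as [Hy|Hy].
  - exists (acos x). split; [lra|]. rewrite cos_acos, S, Rabs_pos_eq; auto.
  - exists (2 * PI - acos x). split.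
    + split; [lra|]. destruct (Req_dec (acos x) 0) as [E|E]; [|lra].
      exfalso. rewrite E, sin_0 in S. symmetry in S. apply Rabs_eq_0 in S. lra.
    + replace (2 * PI - acos x) with (- acos x + 2 * PI) by ring.
      pose proof (cos_period (- acos x) 1) as C1. pose proof (sin_period (- acos x) 1) as S1.
      simpl in C1, S1. rewrite Rmult_1_r in C1, S1. rewrite C1, S1, cos_neg, sin_neg, cos_acos, S; auto.
      rewrite Rabs_left by lra. f_equal; ring.
Qed.

Lemma Hp_norm_eq0 p f z : 0 < p -> Hardy p f -> Hp_norm p f = 0 -> Cmod z < 1 -> f z = zero.
Proof.
  intros Hp Hf H0 Hz. set (r := Cmod z). pose proof (Cmod_ge_0 z).
  assert (Hr : 0 <= r < 1) by (unfold r; lra).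
  assert (E : exists t, 0 <= t < 2 * PI /\ z = (r * cos t, r * sin t)).
  { pose proof two_pi_pos. destruct (Ceq_dec z (RtoC 0)) as [->|Hz0].
    - exists 0. split; [lra|]. unfold r. rewrite Cmod_0. unfold RtoC. f_equal; ring.
    - assert (Hrp : 0 < r) by now apply Cmod_gt_0.
      destruct (polar_form (RtoC (/ r) * z)%C) as [t [Ht E]].
      + rewrite Cmod_mult, Cmod_R, Rabs_pos_eq; [fold r; apply Rinv_l; lra|].
        left; now apply Rinv_0_lt_compat.
      + exists t. split; auto. clearbody r. destruct z as [x y]. unfold Cmult, RtoC in E; simpl in E.
        injection E as E1 E2. rewrite <- E1, <- E2. f_equal; field; lra. }
  destruct E as [t [Ht E]]. rewrite E. clearbody r. apply norm_eq_zero.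
  assert (Q : circle_norm p (fun t => norm (on_circle f r t)) = 0).
  { apply Rle_antisym; [|apply circle_norm_ge0]. rewrite <- H0.
    exact (Hp_mean_le_norm p f r Hf Hr). }
  exact (circle_norm_eq0 p (fun t => norm (on_circle f r t)) t Hp
    (fun s => on_circle_cont f r s Hr (proj1 Hf)) (fun s => norm_ge_0 _) Ht Q).
Qed.

End Analytic.
Section Derivative.
Context {K : CompleteNormedModule C_AbsRing}.

Definition hderiv (f : C -> K) (z : C) : K :=
  iota (fun l : K => is_derive (K := C_AbsRing) f z l).

Lemma hderiv_unique (f : C -> K) z l : is_derive (K := C_AbsRing) f z l -> hderiv f z = l.
Proof.
  intros H. apply (is_derive_C_unique f z); [|easy].
  apply (iota_correct (fun l : K => is_derive (K := C_AbsRing) f z l)).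
  exists l. split; [easy|]. intros l' Hl'. now apply (is_derive_C_unique f z).
Qed.

Lemma hderiv_correct (f : C -> K) z :
  ex_derive (K := C_AbsRing) f z -> is_derive (K := C_AbsRing) f z (hderiv f z).
Proof. intros [l Hl]. now rewrite (hderiv_unique f z l). Qed.

Lemma hderiv_plus (f g : C -> K) z : analytic f -> analytic g -> Cmod z < 1 ->
  hderiv (fun w => plus (f w) (g w)) z = plus (hderiv f z) (hderiv g z).
Proof.
  intros Hf Hg Hz. apply hderiv_unique. apply (is_derive_plus f g); apply hderiv_correct; auto.
Qed.

Lemma hderiv_scal (a : C) (f : C -> K) z : analytic f -> Cmod z < 1 ->
  hderiv (fun w => scal (a : C_AbsRing) (f w)) z = scal (a : C_AbsRing) (hderiv f z).
Proof.
  intros Hf Hz. apply hderiv_unique. exact (is_derive_scal_C a f z _ (hderiv_correct f z (Hf z Hz))).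
Qed.

Lemma hderiv_zero z : hderiv (fun _ => zero) z = zero.
Proof. apply hderiv_unique. exact (is_derive_const (K := C_AbsRing) (V := K) zero z). Qed.

Lemma is_derive_radial (f : C -> K) (z : C) (s : R) (l : K) :
  is_derive (K := C_AbsRing) f (RtoC s * z)%C l ->
  is_derive (K := R_AbsRing) (V := realify K) (fun t : R => f (RtoC t * z)%C) s
    (scal (z : C_AbsRing) l).
Proof.
  intros [_ H]. split; [apply is_linear_scal_l|].
  intros x Hx. apply (@is_filter_lim_locally_unique R_AbsRing (AbsRing_NormedModule R_AbsRing)) in Hx. subst x. intros eps.
  specialize (H _ (fun P HP => HP)).
  set (m := Cmod z + 1). assert (Hm : 0 < m) by (unfold m; pose proof (Cmod_ge_0 z); lra).
  assert (He : 0 < eps / m) by (apply Rdiv_lt_0_compat; [apply eps|easy]).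
  destruct (H (mkposreal _ He)) as [d Hd].
  assert (Hdm : 0 < d / m) by (apply Rdiv_lt_0_compat; [apply d|easy]).
  exists (mkposreal _ Hdm). intros t Ht.
  assert (Ht' : Rabs (t - s) < d / m) by exact Ht.
  assert (E : (Cplus (RtoC t * z) (- (RtoC s * z)) = RtoC (t - s) * z)%C)
    by (rewrite RtoC_minus; ring).
  assert (EC : Cmod (Cplus (RtoC t * z) (- (RtoC s * z)))%C = Rabs (t - s) * Cmod z)
    by (now rewrite E, Cmod_mult, Cmod_R).
  assert (Hz : Rabs (t - s) * Cmod z <= Rabs (t - s) * m)
    by (apply Rmult_le_compat_l; [apply Rabs_pos|unfold m; lra]).
  assert (B : ball (M := AbsRing_UniformSpace C_AbsRing) (RtoC s * z)%C d (RtoC t * z)%C).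
  { change (Cmod (Cplus (RtoC t * z) (- (RtoC s * z)))%C < d). rewrite EC.
    apply (Rmult_lt_compat_r m) in Ht'; [|easy].
    replace (d / m * m) with (pos d) in Ht' by (field; lra). lra. }
  specialize (Hd _ B).
  assert (Hd' : norm (minus (minus (f (RtoC t * z)%C) (f (RtoC s * z)%C))
      (scal (RtoC (t - s) * z : C_AbsRing)%C l)) <= eps / m * (Rabs (t - s) * Cmod z)).
  { rewrite <- E, <- EC. exact Hd. }
  assert (E2 : scal (RtoC (t - s) * z : C_AbsRing)%C l =
      scal (RtoC (t - s) : C_AbsRing) (scal (z : C_AbsRing) l)).
  { symmetry. exact (@scal_assoc C_Ring K (RtoC (t - s)) z l). }
  rewrite E2 in Hd'.
  change (norm (minus (minus (f (RtoC t * z)%C) (f (RtoC s * z)%C))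
      (scal (RtoC (t - s) : C_AbsRing) (scal (z : C_AbsRing) l))) <= eps * Rabs (t - s)).
  eapply Rle_trans; [exact Hd'|].
  apply Rle_trans with (eps / m * (Rabs (t - s) * m)).
  - apply Rmult_le_compat_l; lra.
  - right. field. lra.
Qed.

Lemma Cmod_radial (s : R) (z : C) : 0 <= s <= 1 -> Cmod z < 1 -> Cmod (RtoC s * z) < 1.
Proof.
  intros Hs Hz. rewrite Cmod_mult, Cmod_R, Rabs_pos_eq by lra.
  pose proof (Cmod_ge_0 z). nra.
Qed.

Lemma analytic_deriv_zero (f : C -> K) : analytic f ->
  (forall z, Cmod z < 1 -> hderiv f z = zero) -> forall z, Cmod z < 1 -> f z = f (RtoC 0).
Proof.
  intros Hf H0 z Hz.
  assert (I : is_RInt (V := realify K) (fun _ : R => zero) 0 1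
    (minus (G := realify K) (f (RtoC 1 * z)%C) (f (RtoC 0 * z)%C))).
  { apply (is_RInt_derive (V := realify K) (fun t : R => f (RtoC t * z)%C) (fun _ => zero)).
    - intros s. rewrite Rmin_left, Rmax_right by lra. intros Hs.
      pose proof (Cmod_radial s z Hs Hz) as Hsz.
      pose proof (is_derive_radial f z s _ (hderiv_correct f _ (Hf _ Hsz))) as D.
      rewrite H0 in D by easy. 
      replace (scal (z : C_AbsRing) (zero : K)) with (zero : K) in D; [exact D|].
      symmetry. exact (@scal_zero_r C_Ring K z).
    - intros s _. apply continuous_const. }
  apply is_RInt_unique in I. rewrite RInt_const in I.
  assert (E : minus (f (RtoC 1 * z)%C) (f (RtoC 0 * z)%C) = zero).
  { transitivity (scal (K := R_Ring) (V := realify K) (1 - 0) (zero : realify K)); [now symmetry|].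
    exact (@scal_zero_r R_Ring (realify K) (1 - 0)). }
  replace (RtoC 1 * z)%C with z in E by ring. replace (RtoC 0 * z)%C with (RtoC 0) in E by ring.
  apply (@plus_reg_r K (opp (f (RtoC 0)))). transitivity (@zero K); [exact E|].
  symmetry. exact (@plus_opp_r K (f (RtoC 0))).
Qed.

End Derivative.

Section Space.
Context (K : CompleteNormedModule C_AbsRing) (p : R).

(* A function on the disk is encoded as a function on [C] that vanishes off the
   disk, so that Leibniz equality of the elements is equality on the disk. *)
Record Sp_fun := mk_Sp {
  Sp_val : C -> K;
  Sp_out : forall z, ~ Cmod z < 1 -> Sp_val z = zero;
  Sp_analytic : analytic Sp_val;
  Sp_hardy : Hardy p (hderiv Sp_val) }.

Lemma Sp_eq (f g : Sp_fun) :
  (forall z, Cmod z < 1 -> Sp_val f z = Sp_val g z) -> f = g.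
Proof.
  destruct f as [f f1 f2 f3], g as [g g1 g2 g3]; simpl; intros H.
  assert (E : f = g).
  { apply functional_extensionality. intros z. destruct (Rlt_dec (Cmod z) 1) as [Hz|Hz]; auto.
    now rewrite f1, g1. }
  subst g. f_equal; apply proof_irrelevance.
Qed.

Context (hp : 1 <= p).

Lemma p_pos : 0 < p.
Proof. lra. Qed.

Definition Sp_zero : Sp_fun.
Proof.
  refine (mk_Sp (fun _ => zero) (fun _ _ => eq_refl) analytic_zero _).
  apply Hardy_ext with (fun _ => zero); [intros; now rewrite hderiv_zero|].
  exact (Hardy_zero p p_pos).
Defined.

Definition Sp_plus (f g : Sp_fun) : Sp_fun.
Proof.
  refine (mk_Sp (fun z => plus (Sp_val f z) (Sp_val g z)) _
    (analytic_plus _ _ (Sp_analytic f) (Sp_analytic g)) _).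
  - intros z Hz. rewrite !Sp_out by easy. exact (@plus_zero_l K zero).
  - apply Hardy_ext with (fun z => plus (hderiv (Sp_val f) z) (hderiv (Sp_val g) z)).
    + intros z Hz. symmetry. apply hderiv_plus; auto using Sp_analytic.
    + exact (Hardy_plus p _ _ hp (Sp_hardy f) (Sp_hardy g)).
Defined.

Definition Sp_scal (a : C) (f : Sp_fun) : Sp_fun.
Proof.
  refine (mk_Sp (fun z => scal (a : C_AbsRing) (Sp_val f z)) _
    (analytic_scal a _ (Sp_analytic f)) _).
  - intros z Hz. rewrite Sp_out by easy. exact (@scal_zero_r C_Ring K a).
  - apply Hardy_ext with (fun z => scal (a : C_AbsRing) (hderiv (Sp_val f) z)).
    + intros z Hz. symmetry. apply hderiv_scal; auto using Sp_analytic.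
    + exact (Hardy_scal p _ a p_pos (Sp_hardy f)).
Defined.

Lemma Sp_plus_comm f g : Sp_plus f g = Sp_plus g f.
Proof. apply Sp_eq. intros z _. apply (@plus_comm K). Qed.
Lemma Sp_plus_assoc f g h : Sp_plus f (Sp_plus g h) = Sp_plus (Sp_plus f g) h.
Proof. apply Sp_eq. intros z _. apply (@plus_assoc K). Qed.
Lemma Sp_plus_zero f : Sp_plus f Sp_zero = f.
Proof. apply Sp_eq. intros z _. apply (@plus_zero_r K). Qed.
Lemma Sp_plus_opp f : Sp_plus f (Sp_scal (- RtoC 1) f) = Sp_zero.
Proof.
  apply Sp_eq. intros z _. simpl. transitivity (plus (Sp_val f z) (opp (Sp_val f z))).
  - f_equal. exact (@scal_opp_one C_Ring K (Sp_val f z)).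
  - apply (@plus_opp_r K).
Qed.

Definition Sp_AbelianMonoid : AbelianMonoid :=
  AbelianMonoid.Pack Sp_fun
    (AbelianMonoid.Mixin Sp_fun Sp_plus Sp_zero Sp_plus_comm Sp_plus_assoc Sp_plus_zero) Sp_fun.

Definition Sp_AbelianGroup : AbelianGroup :=
  AbelianGroup.Pack Sp_fun
    (AbelianGroup.Class Sp_fun (AbelianMonoid.class Sp_AbelianMonoid)
      (AbelianGroup.Mixin Sp_AbelianMonoid (Sp_scal (- RtoC 1)) Sp_plus_opp)) Sp_fun.

Lemma Sp_scal_assoc (a b : C_Ring) f : Sp_scal a (Sp_scal b f) = Sp_scal (mult a b) f.
Proof. apply Sp_eq. intros z _. exact (@scal_assoc C_Ring K a b _). Qed.
Lemma Sp_scal_one f : Sp_scal (one : C_Ring) f = f.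
Proof. apply Sp_eq. intros z _. exact (@scal_one C_Ring K _). Qed.
Lemma Sp_scal_plus_l (a : C_Ring) f g :
  Sp_scal a (Sp_plus f g) = Sp_plus (Sp_scal a f) (Sp_scal a g).
Proof. apply Sp_eq. intros z _. exact (@scal_distr_l C_Ring K a _ _). Qed.
Lemma Sp_scal_plus_r (a b : C_Ring) f :
  Sp_scal (plus a b) f = Sp_plus (Sp_scal a f) (Sp_scal b f).
Proof. apply Sp_eq. intros z _. exact (@scal_distr_r C_Ring K a b _). Qed.

Definition Sp_module_mixin : ModuleSpace.mixin_of C_Ring Sp_AbelianGroup :=
  ModuleSpace.Mixin C_Ring Sp_AbelianGroup Sp_scal
    Sp_scal_assoc Sp_scal_one Sp_scal_plus_l Sp_scal_plus_r.

Definition Sp_norm (f : Sp_fun) : R :=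
  norm (Sp_val f (RtoC 0)) + Hp_norm p (hderiv (Sp_val f)).

Lemma Sp_norm_plus f g : Sp_norm (Sp_plus f g) <= Sp_norm f + Sp_norm g.
Proof.
  unfold Sp_norm. simpl Sp_val.
  rewrite (Hp_norm_ext p _ (fun z => plus (hderiv (Sp_val f) z) (hderiv (Sp_val g) z))).
  2:{ intros z Hz. apply hderiv_plus; auto using Sp_analytic. }
  eapply Rle_trans; [apply Rplus_le_compat|].
  - exact (norm_triangle (Sp_val f (RtoC 0)) (Sp_val g (RtoC 0))).
  - exact (Hp_norm_plus p _ _ hp (Sp_hardy f) (Sp_hardy g)).
  - right. ring.
Qed.

Lemma Sp_norm_scal (a : C_AbsRing) f : Sp_norm (Sp_scal a f) <= abs a * Sp_norm f.
Proof.
  unfold Sp_norm. simpl Sp_val.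
  rewrite (Hp_norm_ext p _ (fun z => scal (a : C_AbsRing) (hderiv (Sp_val f) z))).
  2:{ intros z Hz. apply hderiv_scal; auto using Sp_analytic. }
  rewrite Rmult_plus_distr_l. apply Rplus_le_compat.
  - exact (norm_scal a (Sp_val f (RtoC 0))).
  - exact (Hp_norm_scal_le p _ a p_pos (Sp_hardy f)).
Qed.

Lemma Sp_norm_eq0 f : Sp_norm f = 0 -> f = Sp_zero.
Proof.
  intros H. unfold Sp_norm in H.
  pose proof (norm_ge_0 (Sp_val f (RtoC 0))). pose proof (Hp_norm_ge0 p _ (Sp_hardy f)).
  apply Sp_eq. intros z Hz. simpl.
  rewrite (analytic_deriv_zero (Sp_val f) (Sp_analytic f)); auto.
  - apply (@norm_eq_zero C_AbsRing K). lra.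
  - intros w Hw. apply (Hp_norm_eq0 p _ w p_pos (Sp_hardy f)); [lra|easy].
Qed.

Lemma Sp_norm_zero : Sp_norm Sp_zero = 0.
Proof.
  apply Rle_antisym.
  - replace Sp_zero with (Sp_scal (RtoC 0) Sp_zero).
    + eapply Rle_trans; [apply Sp_norm_scal|]. change (abs (RtoC 0 : C_AbsRing)) with (Cmod 0).
      rewrite Cmod_0. lra.
    + apply Sp_eq. intros z _. exact (@scal_zero_r C_Ring K (RtoC 0)).
  - unfold Sp_norm. pose proof (norm_ge_0 (Sp_val Sp_zero (RtoC 0))).
    pose proof (Hp_norm_ge0 p _ (Sp_hardy Sp_zero)). lra.
Qed.

Definition Sp_ball (f : Sp_AbelianGroup) (e : R) (g : Sp_AbelianGroup) : Prop :=
  Sp_norm (minus g f) < e.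

Lemma Sp_ball_center f (e : posreal) : Sp_ball f e f.
Proof.
  unfold Sp_ball. rewrite minus_eq_zero. change (Sp_norm Sp_zero < e).
  rewrite Sp_norm_zero. apply e.
Qed.

Lemma Sp_ball_sym f g e : Sp_ball f e g -> Sp_ball g e f.
Proof.
  unfold Sp_ball. intros H. rewrite <- opp_minus. 
  eapply Rle_lt_trans; [apply (Sp_norm_scal (- RtoC 1)%C)|].
  change (abs (- RtoC 1 : C_AbsRing)%C) with (Cmod (- RtoC 1)).
  rewrite Cmod_opp, Cmod_1. lra.
Qed.

Lemma Sp_ball_triangle f g h e1 e2 : Sp_ball f e1 g -> Sp_ball g e2 h -> Sp_ball f (e1 + e2) h.
Proof.
  unfold Sp_ball. intros H1 H2. rewrite (@minus_trans Sp_AbelianGroup g h f).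
  eapply Rle_lt_trans; [apply Sp_norm_plus|]. lra.
Qed.

Definition Sp_uniform_mixin : UniformSpace.mixin_of Sp_fun :=
  UniformSpace.Mixin Sp_fun Sp_zero Sp_ball Sp_ball_center Sp_ball_sym Sp_ball_triangle.

Definition Sp_aux : NormedModuleAux C_AbsRing :=
  NormedModuleAux.Pack C_AbsRing Sp_fun
    (NormedModuleAux.Class C_AbsRing Sp_fun
      (ModuleSpace.Class C_Ring Sp_fun (AbelianGroup.class Sp_AbelianGroup) Sp_module_mixin)
      Sp_uniform_mixin) Sp_fun.

Lemma Sp_compat1 (f g : Sp_aux) (e : R) : Sp_norm (minus g f) < e -> ball f e g.
Proof. exact (fun H => H). Qed.

Lemma Sp_compat2 (f g : Sp_aux) (e : posreal) : ball f e g -> Sp_norm (minus g f) < 1 * e.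
Proof. rewrite Rmult_1_l. exact (fun H => H). Qed.

Definition Sp_normed_mixin : NormedModule.mixin_of C_AbsRing Sp_aux :=
  NormedModule.Mixin C_AbsRing Sp_aux Sp_norm 1
    Sp_norm_plus Sp_norm_scal Sp_compat1 Sp_compat2 Sp_norm_eq0.

Definition Sp : NormedModule C_AbsRing :=
  NormedModule.Pack C_AbsRing Sp_fun
    (NormedModule.Class C_AbsRing Sp_fun (NormedModuleAux.class C_AbsRing Sp_aux)
      Sp_normed_mixin) Sp_fun.

End Space.

Arguments Sp_val {K p} _ _.
Arguments Sp K {p} hp.

Section Hilbert.
Context {K : CompleteNormedModule C_AbsRing}.

(* [K] with the inner product [ip] is a Hilbert space: completeness is part of
   [CompleteNormedModule]; definiteness follows from [ip_norm]. *)
Record is_inner_product (ip : K -> K -> C) : Prop := {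
  ip_plus : forall x y z, ip (plus x y) z = (ip x z + ip y z)%C;
  ip_scal : forall (a : C) x y, ip (scal (a : C_AbsRing) x) y = (a * ip x y)%C;
  ip_sym : forall x y, ip y x = Cconj (ip x y);
  ip_norm : forall x, ip x x = RtoC (norm x ^ 2) }.

Definition separable : Prop :=
  exists d : nat -> K, forall (x : K) (e : posreal), exists n, ball x e (d n).

Definition unitary (ip : K -> K -> C) (U : K -> K) : Prop :=
  is_linear U /\ (forall x y, ip (U x) (U y) = ip x y) /\ (forall y, exists x, U x = y).

(* [eigenvalue A] is the point spectrum of [A]. *)
Definition eigenvalue (A : K -> K) (mu : C) : Prop :=
  exists x, x <> zero /\ A x = scal (mu : C_AbsRing) x.

(* The integral of [h] along the segment from [0] to [z]. *)
Definition integral_0 (h : C -> K) (z : C) : K :=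
  RInt (V := realify K) (fun t : R => scal (z : C_AbsRing) (h (RtoC t * z)%C)) 0 1.

End Hilbert.

Section Disk.

Definition analytic_C (f : C -> C) : Prop := analytic (V := C_NormedModule) f.

Definition disk_automorphism (phi : C -> C) : Prop :=
  analytic_C phi /\ (forall z, Cmod z < 1 -> Cmod (phi z) < 1) /\
  exists psi : C -> C,
    analytic_C psi /\ (forall z, Cmod z < 1 -> Cmod (psi z) < 1) /\
    (forall z, Cmod z < 1 -> psi (phi z) = z) /\
    (forall z, Cmod z < 1 -> phi (psi z) = z).

Definition Cexp (z : C) : C := (exp (fst z) * cos (snd z), exp (fst z) * sin (snd z)).

(* [g] is an analytic branch of [phi' ^ (1 / p)] on the disk; [L] is the
   corresponding branch of [log phi']. *)
Definition power_branch (p : R) (phi g : C -> C) : Prop :=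
  exists L : C -> C, analytic_C L /\
    forall z, Cmod z < 1 ->
      Cexp (L z) = C_derive phi z /\ g z = Cexp (RtoC (/ p) * L z)%C.

(* [iter_branch g phi n z] is the product of [g (phi^k z)] over [k < n]. If [g] is
   a branch of [phi' ^ (1 / p)] then, by the chain rule, this is a branch of
   [(phi^n)' ^ (1 / p)], namely the one occurring in the [n]-th iterate of
   [h |-> g * (h o phi)]. When [phi^n] is the identity it is a constant [c] with
   [c ^ p = 1], but [c] need not be [1]: for [p = 3] and [phi] a rotation by a
   primitive cube root of unity [w], [n = 3], it is [w] for every branch [g]. *)
Fixpoint iter_branch (g phi : C -> C) (n : nat) (z : C) : C :=
  match n with
  | O => RtoC 1
  | S k => (g (Nat.iter k phi z) * iter_branch g phi k z)%C
  end.

End Disk.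

Section Projections.
Context {X : NormedModule C_AbsRing}.

Definition projection (P : X -> X) : Prop :=
  is_linear P /\ forall x, P (P x) = P x.

Definition surjective_isometry (T : X -> X) : Prop :=
  (forall x y, norm (minus (T x) (T y)) = norm (minus x y)) /\
  (forall y, exists x, T x = y).

Definition bicircular_projection (P : X -> X) : Prop :=
  projection P /\
  exists lam : C, Cmod lam = 1 /\ lam <> RtoC 1 /\
    surjective_isometry (fun x => plus (P x) (scal (lam : C_AbsRing) (minus x (P x)))).

Definition tri_comb (P0 P1 P2 : X -> X) (l1 l2 : C) (x : X) : X :=
  plus (plus (P0 x) (scal (l1 : C_AbsRing) (P1 x))) (scal (l2 : C_AbsRing) (P2 x)).

Definition proj_family (P0 P1 P2 : X -> X) : Prop :=
  (projection P0 /\ projection P1 /\ projection P2) /\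
  ((exists x, P0 x <> zero) /\ (exists x, P1 x <> zero) /\ (exists x, P2 x <> zero)) /\
  ((exists x, P0 x <> P1 x) /\ (exists x, P0 x <> P2 x) /\ (exists x, P1 x <> P2 x)) /\
  (forall x, plus (plus (P0 x) (P1 x)) (P2 x) = x) /\
  (forall x, P0 (P1 x) = zero /\ P1 (P0 x) = zero /\
             P0 (P2 x) = zero /\ P2 (P0 x) = zero /\
             P1 (P2 x) = zero /\ P2 (P1 x) = zero).

Definition generalized_tricircular (P0 P1 P2 : X -> X) : Prop :=
  proj_family P0 P1 P2 /\
  exists l1 l2 : C, Cmod l1 = 1 /\ Cmod l2 = 1 /\ l1 <> RtoC 1 /\ l2 <> RtoC 1 /\ l1 <> l2 /\
    surjective_isometry (tri_comb P0 P1 P2 l1 l2).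

Definition tricircular (P0 P1 P2 : X -> X) : Prop :=
  proj_family P0 P1 P2 /\
  forall l1 l2 : C, Cmod l1 = 1 -> Cmod l2 = 1 ->
    surjective_isometry (tri_comb P0 P1 P2 l1 l2).

End Projections.

(* Main.v *)
Require Import Defs.
From Stdlib Require Import Reals Lra Classical FunctionalExtensionality.
From Coquelicot Require Import Coquelicot.
Open Scope R_scope.

(** Differentiating the formula for [T] gives [(T f)' = g * U (f' o phi)] and
    [(T f)(0) = V (f(0))], while [T] is a root of [(t - 1) (t - l1) (t - l2)].
    Testing this cubic relation on functions whose derivative is a scalar cubic
    polynomial times a vector, with roots at chosen points of the orbit of [z],
    isolates its terms. If some [z] has [z], [phi z], [phi^2 z] distinct, then
    [phi^3 z = z] and the two middle coefficients of the cubic vanish, so [T^3 = I].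
    Otherwise [phi^2] is the identity on the disk. If [phi] is not, the coefficients
    satisfy [(1 + l1) (1 + l2) (l1 + l2) = 0], and up to a unimodular scalar [T^2]
    exhibits one of the projections as bi-circular. If [phi] is the identity, the
    components of [f(0)] and [f'(z)] are eigenvectors of the unitary operators [V] and
    [g(z) U] for distinct eigenvalues, hence orthogonal, and unimodular multipliers
    preserve the norm pointwise. *)

(* The uniform structure underlying complex derivatives; it is equivalent to, but not
   convertible with, the product structure [C_UniformSpace]. *)
Local Notation CU := (AbsRing_UniformSpace C_AbsRing).

Lemma minus_zero_l {G : AbelianGroup} (x : G) : minus zero x = opp x.
Proof. apply plus_zero_l. Qed.

(** * Real derivatives along rays and differentiation of the integral formula *)

Section RealDerivative.
Context {K : CompleteNormedModule C_AbsRing}.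

(** The function [f - f] vanishes and has derivative [a - b], so its approximation error at the
    nonzero increment [d / 2] bounds the norm of [a - b] by every positive [e]. *)
Lemma is_derive_realify_unique (f : R -> K) (x : R) (a b : K) :
  is_derive (V := realify K) f x a -> is_derive (V := realify K) f x b -> a = b.
Proof.
  intros Ha Hb.
  pose proof (is_derive_minus (V := realify K) _ _ _ _ _ Ha Hb) as [_ H].
  specialize (H x (fun P HP => HP)).
  set (l := minus (G := realify K) a b) in *.
  assert (E : l = zero).
  { apply (@norm_eq_zero C_AbsRing K). apply Rle_antisym; [|apply norm_ge_0].
    apply le_epsilon. intros e He. rewrite Rplus_0_l.
    destruct (H (mkposreal e He)) as [d Hd]. pose proof (cond_pos d) as Hdp.
    assert (B : ball (M := AbsRing_UniformSpace R_AbsRing) x d (x + d / 2)).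
    { change (Rabs (x + d / 2 - x) < d). replace (x + d / 2 - x) with (d / 2) by ring.
      rewrite Rabs_pos_eq; lra. }
    specialize (Hd _ B).
    assert (Hd' : norm (minus (G := K) (minus (minus (f (x + d / 2)) (f (x + d / 2))) (minus (f x) (f x)))
      (scal (RtoC (x + d / 2 - x) : C_AbsRing) (l : K))) <= e * Rabs (x + d / 2 - x)) by exact Hd.
    rewrite !(@minus_eq_zero K), (@minus_zero_l K) in Hd'.
    rewrite (@norm_opp C_AbsRing K), (@norm_scal_C K), Cmod_R in Hd'.
    replace (x + d / 2 - x) with (d / 2) in Hd' by ring.
    rewrite Rabs_pos_eq in Hd' by lra. apply Rmult_le_reg_l with (d / 2); [lra|].
    rewrite (Rmult_comm _ e). exact Hd'. }
  apply (@plus_reg_r K (opp b)). transitivity (@zero K); [exact E|].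
  symmetry. exact (@plus_opp_r K b).
Qed.

Lemma is_linear_realify (U : K -> K) : is_linear (K := C_AbsRing) (U := K) (V := K) U ->
  is_linear (K := R_AbsRing) (U := realify K) (V := realify K) U.
Proof.
  intros [H1 H2 H3]. split; [exact H1| |exact H3].
  intros a x. exact (H2 (RtoC a) x).
Qed.

Lemma continuous_ray (z : C) (t : R) :
  continuous (U := CU) (fun s : R => RtoC s * z)%C t.
Proof.
  (* [locally_C] passes from [CU] to the product structure, where the two coordinates can be treated
     separately. *)
  intros P HP. apply locally_C in HP. revert P HP.
  destruct z as [x y].
  change (continuous (T := R_UniformSpace) (U := C_UniformSpace) (fun s : R => RtoC s * (x, y))%C t).
  apply (continuous_ext (U := C_UniformSpace) (fun s : R => (s * x, s * y))).
  { intros s. unfold RtoC, Cmult; simpl. f_equal; ring. }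
  apply (continuous_comp_2 (fun s : R => s * x) (fun s : R => s * y) (fun x y : R => (x, y))).
  - apply (continuous_scal_l (fun s : R => s) x). apply continuous_id.
  - apply (continuous_scal_l (fun s : R => s) y). apply continuous_id.
  - intros P HP. unfold filtermap. apply (filter_imp P); [|exact HP]. now intros [a b].
Qed.

Lemma continuous_integrand (h : C -> K) (z : C) (t : R) :
  (forall w, Cmod w < 1 -> continuous (T := CU) h w) -> Cmod (RtoC t * z) < 1 ->
  continuous (fun s : R => scal (z : C_AbsRing) (h (RtoC s * z)%C)) t.
Proof.
  intros Hh Ht. apply (continuous_scal_r (z : C_AbsRing) (fun s : R => h (RtoC s * z)%C)).
  apply (continuous_comp (V := CU) (fun s : R => RtoC s * z)%C h); [apply continuous_ray|now apply Hh].
Qed.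

Lemma Cmod_ray (t : R) (z : C) : Rabs t * Cmod z < 1 ->
  forall s, Rmin 0 t <= s <= Rmax 0 t -> Cmod (RtoC s * z) < 1.
Proof.
  intros Ht s Hs. rewrite Cmod_mult, Cmod_R.
  eapply Rle_lt_trans; [|exact Ht]. apply Rmult_le_compat_r; [apply Cmod_ge_0|].
  unfold Rmin, Rmax in Hs. destruct (Rle_dec 0 t).
  - rewrite !Rabs_pos_eq; lra.
  - rewrite !Rabs_left1; lra.
Qed.

(** The substitution [s |-> t s] turns the integral over the segment ending at [t z] into one with
    variable upper limit [t], ready for the fundamental theorem of calculus. *)
Lemma integral_0_ray (h : C -> K) (z : C) (t : R) :
  (forall w, Cmod w < 1 -> continuous (T := CU) h w) -> Rabs t * Cmod z < 1 ->
  integral_0 h (RtoC t * z)%C =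
  RInt (V := realify K) (fun s : R => scal (z : C_AbsRing) (h (RtoC s * z)%C)) 0 t.
Proof.
  intros Hh Ht. unfold integral_0.
  set (k := fun s : R => scal (z : C_AbsRing) (h (RtoC s * z)%C)).
  pose proof (RInt_comp_lin (V := realify K) k t 0 0 1) as H.
  replace (t * 0 + 0) with 0 in H by ring. replace (t * 1 + 0) with t in H by ring.
  rewrite <- H.
  - apply (RInt_ext (V := realify K)). intros s _. rewrite Rplus_0_r. unfold k.
    change (scal (RtoC t * z : C_AbsRing)%C (h (RtoC s * (RtoC t * z))%C) =
      scal (RtoC t : C_AbsRing) (scal (z : C_AbsRing) (h (RtoC (t * s) * z)%C))).
    rewrite scal_assoc. f_equal. f_equal. rewrite RtoC_mult. ring.
  - apply (ex_RInt_continuous (V := realify K)). intros s Hs.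
    apply continuous_integrand; auto. now apply Cmod_ray with t.
Qed.

(** As [F] is analytic, its derivative at [z] can be read off the ray: [t |-> F (t z)] has
    derivative [z F'(z)] at [t = 1] by the chain rule and [U (z h(z))] by the fundamental theorem;
    then [z] is cancelled. *)
Lemma hderiv_integral_nonzero (F h : C -> K) (a : K) (U : K -> K) (z : C) :
  (forall w, Cmod w < 1 -> continuous (T := CU) h w) ->
  is_linear (K := C_AbsRing) (U := K) (V := K) U -> analytic F ->
  (forall w, Cmod w < 1 -> F w = plus a (U (integral_0 h w))) ->
  Cmod z < 1 -> z <> RtoC 0 -> hderiv F z = U (h z).
Proof.
  intros Hh HU HF EF Hz Hz0.
  set (k := fun s : R => scal (z : C_AbsRing) (h (RtoC s * z)%C)).
  assert (E1 : (RtoC 1 * z)%C = z) by ring.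
  assert (D1 : is_derive (V := realify K) (fun t : R => F (RtoC t * z)%C) 1
    (scal (z : C_AbsRing) (hderiv F z))).
  { apply is_derive_radial. rewrite E1. apply hderiv_correct. now apply HF. }
  (* A derivative at [t = 1] also looks beyond the segment: [t z] stays in the disk for [t] within
     [1 / |z| - 1] of [1]. *)
  assert (Hl : locally 1 (fun t : R => Rabs t * Cmod z < 1)).
  { pose proof (proj1 (Cmod_gt_0 z) Hz0) as Hm.
    assert (Hd : 0 < / Cmod z - 1).
    { apply Rlt_0_minus. rewrite <- Rinv_1. apply Rinv_lt_contravar; lra. }
    exists (mkposreal _ Hd). intros t Ht.
    assert (Ht' : Rabs (t - 1) < / Cmod z - 1) by exact Ht.
    assert (Rabs t < / Cmod z).
    { replace t with ((t - 1) + 1) by ring. eapply Rle_lt_trans; [apply Rabs_triang|].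
      rewrite Rabs_R1. lra. }
    apply Rmult_lt_reg_r with (/ Cmod z); [now apply Rinv_0_lt_compat|].
    rewrite Rmult_assoc, Rinv_r, Rmult_1_r, Rmult_1_l by lra. easy. }
  assert (D2 : is_derive (V := realify K) (fun t : R => F (RtoC t * z)%C) 1 (U (k 1))).
  { apply (is_derive_ext_loc (V := realify K) (fun t => plus a (U (RInt (V := realify K) k 0 t)))).
    - eapply filter_imp; [|exact Hl]. intros t Ht. simpl.
      rewrite EF by (rewrite Cmod_mult, Cmod_R; exact Ht).
      f_equal. f_equal. symmetry. now apply integral_0_ray.
    - assert (D3 : is_derive (V := realify K) (fun t => U (RInt (V := realify K) k 0 t)) 1 (U (k 1))).
      { apply (filterdiff_ext_lin (V := realify K) _ (fun y : R => U (real_scal K y (k 1)))).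
        - apply (filterdiff_comp' (K := R_AbsRing) (V := realify K) (W := realify K)
            (fun t => RInt (V := realify K) k 0 t) U).
          + apply (is_derive_RInt (V := realify K) k _ 0).
            * eapply filter_imp; [|exact Hl]. intros t Ht. apply (RInt_correct (V := realify K)).
              apply (ex_RInt_continuous (V := realify K)). intros s Hs.
              apply continuous_integrand; auto. now apply Cmod_ray with t.
            * apply continuous_integrand; auto. now rewrite E1.
          + apply (filterdiff_linear (K := R_AbsRing)). now apply is_linear_realify.
        - intros y. exact (linear_scal U HU (RtoC y) (k 1)). }
      pose proof (is_derive_plus (V := realify K) _ _ _ _ _ (is_derive_const (V := realify K) a 1) D3) as D4.
      exact (eq_ind _ (is_derive (V := realify K) _ 1) D4 _ (@plus_zero_l K (U (k 1)))). }
  pose proof (is_derive_realify_unique _ _ _ _ D1 D2) as E.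
  unfold k in E. rewrite E1 in E.
  assert (E' : scal (z : C_AbsRing) (hderiv F z) = scal (z : C_AbsRing) (U (h z))).
  { rewrite E. exact (linear_scal U HU z (h z)). }
  apply (f_equal (scal (/ z : C_AbsRing)%C)) in E'. rewrite !scal_assoc in E'.
  replace (mult (/ z : C_AbsRing)%C (z : C_AbsRing)) with (one : C_AbsRing) in E'.
  - now rewrite !scal_one in E'.
  - unfold mult, one; simpl. symmetry. now apply Cinv_l.
Qed.

Lemma continuous_linear (U : K -> K) (f : C -> K) (z : C) :
  is_linear (K := C_AbsRing) (U := K) (V := K) U ->
  continuous (T := CU) f z -> continuous (T := CU) (fun w => U (f w)) z.
Proof.
  intros HU Hf. apply (continuous_comp (U := CU) f U); [exact Hf|].
  apply (filterdiff_continuous U). exists U. now apply filterdiff_linear.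
Qed.

(** Both values are limits along the points [1 / (n + 2)], which are nonzero and, thanks to the
    shift by [2], in the disk already for [n = 0]. *)
Lemma continuous_eq_at_0 (f h : C -> K) :
  continuous (T := CU) f (RtoC 0) -> continuous (T := CU) h (RtoC 0) ->
  (forall z, Cmod z < 1 -> z <> RtoC 0 -> f z = h z) -> f (RtoC 0) = h (RtoC 0).
Proof.
  intros Hf Hh E.
  assert (R0 : filterlim (fun n : nat => RtoC (/ (INR n + 2))) eventually (locally (T := CU) (RtoC 0))).
  { apply (filterlim_comp nat R CU (fun n => / (INR n + 2)) RtoC eventually (locally 0)).
    - apply (is_lim_seq_inv _ p_infty); [|easy].
      apply (is_lim_seq_plus _ _ p_infty 2); [apply is_lim_seq_INR|apply is_lim_seq_const|easy].
    - pose proof (continuous_ray (RtoC 1) 0) as H. rewrite <- (Cmult_1_r (RtoC 0)).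
      intros P HP. apply H in HP. unfold filtermap in *. eapply filter_imp; [|exact HP].
      intros s Hs. cbv beta in Hs. now rewrite Cmult_1_r in Hs. }
  apply (filterlim_locally_unique (F := eventually) (fun n : nat => f (RtoC (/ (INR n + 2))))).
  - now apply (filterlim_comp nat CU K _ f eventually (locally (T := CU) (RtoC 0))).
  - apply (filterlim_ext (fun n : nat => h (RtoC (/ (INR n + 2))))).
    + intros n. pose proof (pos_INR n). symmetry. apply E.
      * rewrite Cmod_R, Rabs_pos_eq by (left; apply Rinv_0_lt_compat; lra).
        rewrite <- Rinv_1. apply Rinv_lt_contravar; lra.
      * intros H0. apply RtoC_inj in H0. revert H0. apply Rinv_neq_0_compat. lra.
    + now apply (filterlim_comp nat CU K _ h eventually (locally (T := CU) (RtoC 0))).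
Qed.

(** At the origin the ray degenerates and the factor [z] cannot be cancelled; there the identity
    follows by continuity of both sides. *)
Lemma hderiv_integral (F h : C -> K) (a : K) (U : K -> K) :
  (forall w, Cmod w < 1 -> continuous (T := CU) h w) ->
  is_linear (K := C_AbsRing) (U := K) (V := K) U -> analytic F -> analytic (hderiv F) ->
  (forall w, Cmod w < 1 -> F w = plus a (U (integral_0 h w))) ->
  forall z, Cmod z < 1 -> hderiv F z = U (h z).
Proof.
  intros Hh HU HF HF' EF z Hz.
  destruct (Ceq_dec z (RtoC 0)) as [->|Hz0]; [|now apply (hderiv_integral_nonzero F h a U)].
  apply (continuous_eq_at_0 (hderiv F) (fun w => U (h w))).
  - apply (ex_derive_continuous (hderiv F)). now apply HF'.
  - apply continuous_linear; auto.
  - intros w Hw Hw0. now apply (hderiv_integral_nonzero F h a U).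
Qed.

End RealDerivative.

(** * Test functions whose derivative is a cubic polynomial times a vector *)

Section TestFunctions.
Context {K : CompleteNormedModule C_AbsRing} {p : R} (hp : 1 <= p).

(** Cutting [F] off outside the disk fits the encoding of [Sp_fun] and leaves derivatives inside
    unchanged; a pointwise bound on [h] bounds all its circle means. *)
Lemma Sp_of_bounded_derivative (F h : C -> K) (M : R) :
  (forall w, Cmod w < 1 -> is_derive (K := C_AbsRing) F w (h w)) -> analytic h ->
  (forall w, Cmod w < 1 -> norm (h w) <= M) ->
  exists f : Sp K hp, forall w, Cmod w < 1 -> Sp_val f w = F w /\ hderiv (Sp_val f) w = h w.
Proof.
  intros HF Hh HM.
  set (F0 := fun w => if Rlt_dec (Cmod w) 1 then F w else zero).
  assert (EF : forall w, Cmod w < 1 -> F w = F0 w).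
  { intros w Hw. unfold F0. now destruct (Rlt_dec (Cmod w) 1). }
  assert (D : forall w, Cmod w < 1 -> is_derive (K := C_AbsRing) F0 w (h w)).
  { intros w Hw. apply (is_derive_ext_loc F); [|now apply HF].
    eapply filter_imp; [|now apply locally_disk]. exact EF. }
  assert (D' : forall w, Cmod w < 1 -> h w = hderiv F0 w).
  { intros w Hw. symmetry. apply hderiv_unique. now apply D. }
  assert (H0 : forall w, ~ Cmod w < 1 -> F0 w = zero).
  { intros w Hw. unfold F0. now destruct (Rlt_dec (Cmod w) 1). }
  assert (HA : analytic F0) by (intros w Hw; exists (h w); now apply D).
  assert (HH : Hardy p (hderiv F0)).
  { apply Hardy_ext with h; [exact D'|]. split; [exact Hh|].
    exists (circle_norm p (fun _ => M)). intros r Hr. unfold Hp_mean.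
    apply circle_norm_le; [lra| | | |].
    - intros t. now apply on_circle_cont.
    - intros t. apply continuous_const.
    - intros t. apply norm_ge_0.
    - intros t. apply HM. rewrite Cmod_polar; lra. }
  exists (mk_Sp K p F0 H0 HA HH). intros w Hw. simpl. split; symmetry; auto.
Qed.

Lemma is_derive_C_mult (f g : C -> C) (z a b : C) :
  is_derive (K := C_AbsRing) (V := AbsRing_NormedModule C_AbsRing) f z a ->
  is_derive (K := C_AbsRing) (V := AbsRing_NormedModule C_AbsRing) g z b ->
  is_derive (K := C_AbsRing) (V := AbsRing_NormedModule C_AbsRing)
    (fun w => f w * g w)%C z (a * g z + f z * b)%C.
Proof.
  intros Hf Hg. exact (is_derive_mult (K := C_AbsRing) f g z a b Hf Hg Cmult_comm).
Qed.

(** Degree three allows roots at three of the four points [z], [phi z], [phi^2 z], [phi^3 z]. In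
    Horner form the derivative and the modulus bound come from repeating one step [a + w b]. *)
Definition cubic (c0 c1 c2 c3 w : C) : C := (c0 + w * (c1 + w * (c2 + w * c3)))%C.

Lemma is_derive_cubic (c0 c1 c2 c3 z : C) :
  is_derive (K := C_AbsRing) (V := AbsRing_NormedModule C_AbsRing)
    (cubic c0 c1 c2 c3) z (c1 + 2 * c2 * z + 3 * c3 * z * z)%C.
Proof.
  assert (Did : is_derive (K := C_AbsRing) (V := AbsRing_NormedModule C_AbsRing) (fun w : C => w) z (RtoC 1))
    by exact (is_derive_id (K := C_AbsRing) z).
  assert (Step : forall (a b : C) (q : C -> C),
    is_derive (K := C_AbsRing) (V := AbsRing_NormedModule C_AbsRing) q z b ->
    is_derive (K := C_AbsRing) (V := AbsRing_NormedModule C_AbsRing) (fun w => a + w * q w)%C z (q z + z * b)%C).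
  { intros a b q Hq.
    pose proof (is_derive_plus (K := C_AbsRing) (V := AbsRing_NormedModule C_AbsRing) _ _ _ _ _
      (is_derive_const (K := C_AbsRing) (V := AbsRing_NormedModule C_AbsRing) a z)
      (is_derive_C_mult _ _ _ _ _ Did Hq)) as H.
    replace (q z + z * b)%C with (plus (zero : C_AbsRing) (RtoC 1 * q z + z * b)%C : C); [exact H|].
    unfold plus, zero; simpl. ring. }
  pose proof (Step c0 _ _ (Step c1 _ _ (Step c2 _ _
    (is_derive_const (K := C_AbsRing) (V := AbsRing_NormedModule C_AbsRing) (c3 : C_AbsRing) z)))) as H.
  replace (c1 + 2 * c2 * z + 3 * c3 * z * z)%C with
    ((c1 + z * (c2 + z * c3)) + z * ((c2 + z * c3) + z * (c3 + z * (zero : C_AbsRing))))%C; [exact H|].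
  unfold zero; simpl. ring.
Qed.

Lemma Cmod_cubic (c0 c1 c2 c3 w : C) : Cmod w < 1 ->
  Cmod (cubic c0 c1 c2 c3 w) <= Cmod c0 + (Cmod c1 + (Cmod c2 + Cmod c3)).
Proof.
  intros Hw. pose proof (Cmod_ge_0 w).
  assert (Step : forall a b B, Cmod b <= B -> Cmod (a + w * b) <= Cmod a + B).
  { intros a b B Hb. eapply Rle_trans; [apply Cmod_triangle|]. apply Rplus_le_compat_l.
    rewrite Cmod_mult. pose proof (Cmod_ge_0 b). nra. }
  unfold cubic. repeat apply Step. apply Rle_refl.
Qed.

(** Source of all test functions: the value at [0] probes [V], and the derivative, chosen
    independently, probes [U], [g] and [phi]. *)
Lemma Sp_cubic (y x : K) (c0 c1 c2 c3 : C) :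
  exists f : Sp K hp, Sp_val f (RtoC 0) = y /\
    forall w, Cmod w < 1 -> hderiv (Sp_val f) w = scal (cubic c0 c1 c2 c3 w : C_AbsRing) x.
Proof.
  (* The primitive of the cubic that vanishes at [0], integrated term by term. *)
  set (q := fun w : C => (w * cubic c0 (c1 / 2) (c2 / 3) (c3 / 4) w)%C).
  destruct (Sp_of_bounded_derivative (fun w => plus y (scal (q w : C_AbsRing) x))
    (fun w => scal (cubic c0 c1 c2 c3 w : C_AbsRing) x)
    ((Cmod c0 + (Cmod c1 + (Cmod c2 + Cmod c3))) * norm x)) as [f Hf].
  - intros w Hw.
    assert (D : is_derive (K := C_AbsRing) (V := AbsRing_NormedModule C_AbsRing) q w (cubic c0 c1 c2 c3 w)).
    { pose proof (is_derive_C_mult _ _ w _ _ (is_derive_id (K := C_AbsRing) w)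
        (is_derive_cubic c0 (c1 / 2) (c2 / 3) (c3 / 4) w)) as H.
      assert (E : (one * cubic c0 (c1 / 2) (c2 / 3) (c3 / 4) w + w * (c1 / 2 + 2 * (c2 / 3) * w + 3 * (c3 / 4) * w * w))%C
        = cubic c0 c1 c2 c3 w).
      { unfold cubic. change (one : C_AbsRing) with (RtoC 1). field. }
      exact (eq_ind _ (is_derive (K := C_AbsRing) (V := AbsRing_NormedModule C_AbsRing) q w) H _ E). }
    pose proof (is_derive_plus _ _ _ _ _ (is_derive_const (K := C_AbsRing) (V := K) y w)
      (is_derive_scal_l (K := C_AbsRing) (V := K) q w _ x D)) as H.
    exact (eq_ind _ (is_derive (K := C_AbsRing) (V := K) _ w) H _ (@plus_zero_l K _)).
  - intros w Hw. exists (scal (c1 + 2 * c2 * w + 3 * c3 * w * w : C_AbsRing)%C x).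
    apply (is_derive_scal_l (K := C_AbsRing) (V := K)). apply is_derive_cubic.
  - intros w Hw. cbv beta. rewrite (@norm_scal_C K). apply Rmult_le_compat_r; [apply norm_ge_0|].
    now apply Cmod_cubic.
  - exists f. assert (H0 : Cmod (RtoC 0) < 1) by (rewrite Cmod_0; lra). split.
    + rewrite (proj1 (Hf _ H0)). unfold q. rewrite Cmult_0_l.
      rewrite (@scal_zero_l C_Ring K). apply plus_zero_r.
    + intros w Hw. now apply Hf.
Qed.

End TestFunctions.

(** * Continuity of the branch and basic facts on the automorphism *)

Lemma continuous_pair_CU {T : UniformSpace} (u v : T -> R) (x : T) :
  continuous u x -> continuous v x -> continuous (U := CU) (fun y => (u y, v y)) x.
Proof.
  intros Hu Hv P HP. apply locally_C in HP. revert P HP.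
  apply (continuous_comp_2 u v (fun x y : R => (x, y))); auto.
  intros P HP. unfold filtermap. apply (filter_imp P); [|exact HP]. now intros [a b].
Qed.

Lemma continuous_Cexp_scal (a : R) (w : C) :
  continuous (T := C_UniformSpace) (U := CU) (fun w => Cexp (RtoC a * w)%C) w.
Proof.
  assert (Hf : continuous (T := C_UniformSpace) (fun w : C => a * fst w) w)
    by (apply (continuous_scal_r a (fun w : C_UniformSpace => fst w : R)); apply continuous_fst).
  assert (Hs : continuous (T := C_UniformSpace) (fun w : C => a * snd w) w)
    by (apply (continuous_scal_r a (fun w : C_UniformSpace => snd w : R)); apply continuous_snd).
  assert (He : continuous (T := C_UniformSpace) (fun w : C => exp (a * fst w)) w).
  { apply (continuous_comp (fun w : C_UniformSpace => a * fst w) exp); auto.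
    apply (ex_derive_continuous exp). auto_derive. auto. }
  apply (continuous_ext (T := C_UniformSpace) (U := CU) (fun w : C_UniformSpace =>
    (exp (a * fst w) * cos (a * snd w), exp (a * fst w) * sin (a * snd w)))).
  - intros [x y]. unfold Cexp, Cmult, RtoC; simpl.
    replace (a * x - 0 * y) with (a * x) by ring. replace (a * y + 0 * x) with (a * y) by ring.
    reflexivity.
  - apply continuous_pair_CU.
    + apply (continuous_mult (fun w : C_UniformSpace => exp (a * fst w)) (fun w => cos (a * snd w))); auto.
      apply (continuous_comp (fun w : C_UniformSpace => a * snd w) cos); auto. apply continuous_cos.
    + apply (continuous_mult (fun w : C_UniformSpace => exp (a * fst w)) (fun w => sin (a * snd w))); auto.
      apply (continuous_comp (fun w : C_UniformSpace => a * snd w) sin); auto. apply continuous_sin.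
Qed.

Lemma Cexp_neq_0 (z : C) : Cexp z <> RtoC 0.
Proof.
  intros E. unfold Cexp, RtoC in E. injection E as E1 E2.
  pose proof (exp_pos (fst z)). pose proof (sin2_cos2 (snd z)) as H1. unfold Rsqr in H1.
  apply Rmult_integral in E1. apply Rmult_integral in E2.
  destruct E1 as [E1|E1], E2 as [E2|E2]; try lra. rewrite E1, E2 in H1. lra.
Qed.

Section Branch.
Context {p : R} {phi g : C -> C} (hphi : disk_automorphism phi) (hg : power_branch p phi g).

Lemma branch_neq_0 (z : C) : Cmod z < 1 -> g z <> RtoC 0.
Proof.
  intros Hz. destruct hg as [L [_ H]]. rewrite (proj2 (H z Hz)). apply Cexp_neq_0.
Qed.

Lemma analytic_C_continuous (f : C -> C) (z : C) : analytic_C f -> Cmod z < 1 ->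
  continuous (T := CU) (U := C_UniformSpace) f z.
Proof.
  intros Hf Hz. apply (ex_derive_continuous (K := C_AbsRing) (V := C_NormedModule) f). now apply Hf.
Qed.

Lemma branch_continuous (z : C) : Cmod z < 1 -> continuous (T := CU) (U := CU) g z.
Proof.
  intros Hz. destruct hg as [L [HL H]].
  apply (continuous_ext_loc (T := CU) (U := CU) _ (fun w => Cexp (RtoC (/ p) * L w)%C)).
  - eapply filter_imp; [|now apply locally_disk]. intros w Hw. symmetry. now apply H.
  - apply (continuous_comp (U := CU) (V := C_UniformSpace) (W := CU) L (fun w => Cexp (RtoC (/ p) * w)%C)).
    + now apply analytic_C_continuous.
    + apply continuous_Cexp_scal.
Qed.

Lemma automorphism_disk (z : C) : Cmod z < 1 -> Cmod (phi z) < 1.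
Proof. apply hphi. Qed.

Lemma automorphism_inj (z w : C) : Cmod z < 1 -> Cmod w < 1 -> phi z = phi w -> z = w.
Proof.
  intros Hz Hw E. destruct hphi as [_ [_ [psi [_ [_ [H _]]]]]].
  rewrite <- (H z Hz), <- (H w Hw). now rewrite E.
Qed.

(** Provides the continuity of the integrand that [hderiv_integral] asks for. *)
Lemma continuous_weighted_composition {K : CompleteNormedModule C_AbsRing} (h : C -> K) (z : C) :
  analytic h -> Cmod z < 1 ->
  continuous (T := CU) (fun w => scal (g w : C_AbsRing) (h (phi w))) z.
Proof.
  intros Hh Hz. apply (continuous_scal (U := CU) (K := C_AbsRing) (V := K) g (fun w => h (phi w))).
  - now apply branch_continuous.
  - assert (Hpz := automorphism_disk z Hz).
    apply (continuous_comp (U := CU) (V := CU) (W := K) phi h).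
    + intros P HP. apply locally_C in HP. revert P HP. apply analytic_C_continuous; [apply hphi|easy].
    + apply (ex_derive_continuous (K := C_AbsRing) (V := K) h). now apply Hh.
Qed.

End Branch.

(** * Combinations of three fixed vectors *)

Section Combinations.
Context {X : ModuleSpace C_Ring}.

(** With the components [P0 x], [P1 x], [P2 x] as the fixed triple, combinations of the projections
    act diagonally on the coefficients, so operator identities become scalar ones. *)
Definition lin3 (y0 y1 y2 : X) (a b c : C) : X :=
  plus (plus (scal (a : C_Ring) y0) (scal (b : C_Ring) y1)) (scal (c : C_Ring) y2).

Lemma plus_plus_swap (a b c d : X) : plus (plus a b) (plus c d) = plus (plus a c) (plus b d).
Proof.
  rewrite <- !plus_assoc. f_equal. rewrite !plus_assoc. f_equal. apply plus_comm.
Qed.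

Lemma lin3_plus y0 y1 y2 a b c a' b' c' :
  plus (lin3 y0 y1 y2 a b c) (lin3 y0 y1 y2 a' b' c') = lin3 y0 y1 y2 (a + a') (b + b') (c + c').
Proof.
  unfold lin3. rewrite plus_plus_swap. f_equal; [rewrite plus_plus_swap; f_equal|];
    symmetry; apply (scal_distr_r (K := C_Ring)).
Qed.

Lemma lin3_scal y0 y1 y2 k a b c :
  scal (k : C_Ring) (lin3 y0 y1 y2 a b c) = lin3 y0 y1 y2 (k * a) (k * b) (k * c).
Proof.
  unfold lin3. rewrite !scal_distr_l, !scal_assoc. reflexivity.
Qed.

Lemma lin3_zero y0 y1 y2 : lin3 y0 y1 y2 (RtoC 0) (RtoC 0) (RtoC 0) = zero.
Proof.
  unfold lin3. change (RtoC 0) with (zero : C_Ring). rewrite !scal_zero_l, !plus_zero_l. reflexivity.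
Qed.

Lemma lin3_one y0 y1 y2 : lin3 y0 y1 y2 (RtoC 1) (RtoC 1) (RtoC 1) = plus (plus y0 y1) y2.
Proof. unfold lin3. change (RtoC 1) with (one : C_Ring). now rewrite !scal_one. Qed.

Lemma lin3_opp y0 y1 y2 a b c :
  opp (lin3 y0 y1 y2 a b c) = lin3 y0 y1 y2 (- a) (- b) (- c).
Proof.
  rewrite <- scal_opp_one, lin3_scal. f_equal; unfold opp, one; simpl; ring.
Qed.

End Combinations.

Lemma scal_C_eq_zero {X : NormedModule C_AbsRing} (a : C) (x : X) :
  scal (a : C_AbsRing) x = zero -> a = RtoC 0 \/ x = zero.
Proof.
  intros E0. assert (E : Cmod a * norm x = 0) by (rewrite <- norm_scal_C, E0; exact (@norm_zero C_AbsRing X)).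
  apply Rmult_integral in E. destruct E as [E|E]; [left; now apply Cmod_eq_0|right; now apply norm_eq_zero].
Qed.

(** * Families of three projections and their unimodular combinations *)

Section Family.
Context {X : NormedModule C_AbsRing} {P0 P1 P2 : X -> X} (hP : proj_family P0 P1 P2).

Lemma tri_comb_lin3 m1 m2 x :
  tri_comb P0 P1 P2 m1 m2 x = lin3 (P0 x) (P1 x) (P2 x) (RtoC 1) m1 m2.
Proof. unfold tri_comb, lin3. change (RtoC 1) with (one : C_Ring). now rewrite scal_one. Qed.

Lemma family_sum x : x = lin3 (P0 x) (P1 x) (P2 x) (RtoC 1) (RtoC 1) (RtoC 1).
Proof. rewrite lin3_one. symmetry. apply hP. Qed.

Lemma projection_lin3 (P : X -> X) y0 y1 y2 a b c : projection P ->
  P (lin3 y0 y1 y2 a b c) = lin3 (P y0) (P y1) (P y2) a b c.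
Proof.
  intros [HP _]. unfold lin3. rewrite !(linear_plus P HP), !(linear_scal P HP). reflexivity.
Qed.

(** Idempotence keeps the matching component and mutual annihilation removes the other two. *)
Lemma family_lin3 x a b c :
  P0 (lin3 (P0 x) (P1 x) (P2 x) a b c) = scal (a : C_AbsRing) (P0 x) /\
  P1 (lin3 (P0 x) (P1 x) (P2 x) a b c) = scal (b : C_AbsRing) (P1 x) /\
  P2 (lin3 (P0 x) (P1 x) (P2 x) a b c) = scal (c : C_AbsRing) (P2 x).
Proof.
  destruct hP as [[H0 [H1 H2]] [_ [_ [_ Hz]]]]. destruct (Hz x) as [Z1 [Z2 [Z3 [Z4 [Z5 Z6]]]]].
  rewrite (projection_lin3 P0), (projection_lin3 P1), (projection_lin3 P2) by easy.
  rewrite Z1, Z2, Z3, Z4, Z5, Z6, (proj2 H0), (proj2 H1), (proj2 H2).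
  unfold lin3. rewrite !(@scal_zero_r C_Ring X), ?(@plus_zero_r X), ?(@plus_zero_l X). repeat split; reflexivity.
Qed.

Lemma tri_comb_on_lin3 m1 m2 x a b c :
  tri_comb P0 P1 P2 m1 m2 (lin3 (P0 x) (P1 x) (P2 x) a b c) =
  lin3 (P0 x) (P1 x) (P2 x) a (m1 * b)%C (m2 * c)%C.
Proof.
  unfold tri_comb. destruct (family_lin3 x a b c) as [-> [-> ->]]. rewrite !scal_assoc. reflexivity.
Qed.

Lemma tri_comb_comp m1 m2 n1 n2 x :
  tri_comb P0 P1 P2 m1 m2 (tri_comb P0 P1 P2 n1 n2 x) = tri_comb P0 P1 P2 (m1 * n1) (m2 * n2) x.
Proof. now rewrite (tri_comb_lin3 n1), tri_comb_on_lin3, <- tri_comb_lin3. Qed.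

Lemma tri_comb_one x : tri_comb P0 P1 P2 (RtoC 1) (RtoC 1) x = x.
Proof. rewrite tri_comb_lin3. symmetry. apply family_sum. Qed.

Lemma tri_comb_minus m1 m2 x y :
  minus (tri_comb P0 P1 P2 m1 m2 x) (tri_comb P0 P1 P2 m1 m2 y) = tri_comb P0 P1 P2 m1 m2 (minus x y).
Proof.
  destruct hP as [[[H0 _] [[H1 _] [H2 _]]] _].
  assert (Eo : forall u v : X, minus u v = plus u (scal (opp one : C_AbsRing) v)).
  { intros u v. unfold minus. f_equal. symmetry. exact (@scal_opp_one C_Ring X v). }
  rewrite !Eo. unfold tri_comb. rewrite !(linear_plus _ H0), !(linear_plus _ H1), !(linear_plus _ H2).
  rewrite !(linear_scal _ H0), !(linear_scal _ H1), !(linear_scal _ H2).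
  rewrite !(@scal_distr_l C_AbsRing X), !(@scal_assoc C_AbsRing X).
  assert (Ec : forall a : C_AbsRing, mult (opp one) a = mult a (opp one)) by (intros a; apply Cmult_comm).
  rewrite (Ec m1), (Ec m2).
  rewrite (@plus_plus_swap X). f_equal. apply (@plus_plus_swap X).
Qed.

Lemma family_eigen (l1 l2 : C) x :
  tri_comb P0 P1 P2 l1 l2 (P0 x) = scal (RtoC 1 : C_AbsRing) (P0 x) /\
  tri_comb P0 P1 P2 l1 l2 (P1 x) = scal (l1 : C_AbsRing) (P1 x) /\
  tri_comb P0 P1 P2 l1 l2 (P2 x) = scal (l2 : C_AbsRing) (P2 x).
Proof.
  destruct hP as [[H0 [H1 H2]] [_ [_ [_ Hz]]]]. destruct (Hz x) as [Z1 [Z2 [Z3 [Z4 [Z5 Z6]]]]].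
  unfold tri_comb. rewrite Z1, Z2, Z3, Z4, Z5, Z6, (proj2 H0), (proj2 H1), (proj2 H2).
  rewrite !(@scal_zero_r C_AbsRing X), ?(@plus_zero_r X), ?(@plus_zero_l X).
  change (RtoC 1) with (one : C_AbsRing). rewrite (@scal_one C_AbsRing X). repeat split; reflexivity.
Qed.

(** The coefficients are those of the expanded polynomial [(t - 1) (t - l1) (t - l2)], and [T] acts
    on the three components as its roots [1], [l1], [l2]. *)
Lemma tri_comb_cubic_relation (l1 l2 : C) x (T := tri_comb P0 P1 P2 l1 l2) :
  plus (plus (T (T (T x))) (scal (- (1 + l1 + l2) : C_AbsRing)%C (T (T x))))
    (plus (scal (l1 + l2 + l1 * l2 : C_AbsRing)%C (T x)) (scal (- (l1 * l2) : C_AbsRing)%C x)) = zero.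
Proof.
  unfold T. rewrite !tri_comb_comp.
  rewrite (family_sum x) at 4. rewrite !tri_comb_lin3, !(lin3_scal (X := X)), !(lin3_plus (X := X)).
  etransitivity; [|exact (lin3_zero (P0 x) (P1 x) (P2 x))]. f_equal; ring.
Qed.

Lemma surjective_isometry_comp (S T : X -> X) :
  surjective_isometry S -> surjective_isometry T -> surjective_isometry (fun x => S (T x)).
Proof.
  intros [S1 S2] [T1 T2]. split.
  - intros x y. now rewrite S1, T1.
  - intros y. destruct (S2 y) as [z <-]. destruct (T2 z) as [x <-]. now exists x.
Qed.

Lemma surjective_isometry_scal (c : C) (S : X -> X) : Cmod c = 1 ->
  surjective_isometry S -> surjective_isometry (fun x => scal (c : C_AbsRing) (S x)).
Proof.
  intros Hc [S1 S2]. split.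
  - intros x y.
    assert (E : minus (scal (c : C_AbsRing) (S x)) (scal (c : C_AbsRing) (S y)) =
      scal (c : C_AbsRing) (minus (S x) (S y))).
    { unfold minus. rewrite (@scal_distr_l C_AbsRing X). f_equal. symmetry.
      exact (@scal_opp_r C_Ring X c (S y)). }
    transitivity (norm (scal (c : C_AbsRing) (minus (S x) (S y)) : X)).
    + exact (f_equal (norm (V := X)) E).
    + now rewrite (norm_scal_C (V := X)), Hc, Rmult_1_l.
  - assert (Hc0 : c <> RtoC 0) by (intros ->; rewrite Cmod_0 in Hc; lra).
    intros y. destruct (S2 (scal (/ c : C_AbsRing)%C y)) as [x Hx]. exists x.
    rewrite Hx, scal_assoc. transitivity (scal (one : C_AbsRing) y); [|apply scal_one].
    f_equal. now apply Cinv_r.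
Qed.

Lemma surjective_isometry_ext (S T : X -> X) : (forall x, S x = T x) ->
  surjective_isometry S -> surjective_isometry T.
Proof.
  intros E [S1 S2]. split.
  - intros x y. now rewrite <- !E.
  - intros y. destruct (S2 y) as [x <-]. exists x. now rewrite E.
Qed.

(** The scalar relation makes two of the three eigenvalues [1], [l1^2], [l2^2] of [T^2] coincide.
    Dividing [T^2] by the remaining eigenvalue gives [P + m (I - P)], where [P] is the projection
    belonging to that eigenvalue. *)
Lemma bicircular_of_square (l1 l2 : C) :
  Cmod l1 = 1 -> Cmod l2 = 1 -> l1 <> RtoC 1 -> l2 <> RtoC 1 -> l1 <> l2 ->
  surjective_isometry (tri_comb P0 P1 P2 l1 l2) ->
  ((1 + l1 + l2) * (l1 + l2 + l1 * l2) = l1 * l2)%C ->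
  bicircular_projection P0 \/ bicircular_projection P1 \/ bicircular_projection P2.
Proof.
  intros M1 M2 N1 N2 N12 HT E.
  assert (HTT : surjective_isometry (tri_comb P0 P1 P2 (l1 * l1) (l2 * l2))).
  { apply (surjective_isometry_ext (fun x => tri_comb P0 P1 P2 l1 l2 (tri_comb P0 P1 P2 l1 l2 x))).
    - intros x. apply tri_comb_comp.
    - now apply surjective_isometry_comp. }
  assert (Hint : forall a b : C, (a * b = 0)%C -> a = RtoC 0 \/ b = RtoC 0).
  { intros a b H. destruct (Ceq_dec a (RtoC 0)) as [->|Ha]; [now left|].
    destruct (Ceq_dec b (RtoC 0)) as [->|Hb]; [now right|].
    exfalso. now apply (Cmult_neq_0 a b). }
  assert (Hsq : forall a : C, (a * a = 1)%C -> a = RtoC 1 \/ a = (- (1))%C).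
  { intros a H. destruct (Hint (a - 1) (a + 1))%C as [H'|H'].
    - replace ((a - 1) * (a + 1))%C with (a * a - 1)%C by ring. rewrite H. ring.
    - left. replace a with (a - 1 + 1)%C by ring. rewrite H'. ring.
    - right. replace a with (a + 1 - 1)%C by ring. rewrite H'. ring. }
  assert (Hbi : forall (P : X -> X) (c m : C), projection P -> Cmod c = 1 -> Cmod m = 1 -> m <> RtoC 1 ->
    (forall x, plus (P x) (scal (m : C_AbsRing) (minus x (P x))) =
      scal (c : C_AbsRing) (tri_comb P0 P1 P2 (l1 * l1) (l2 * l2) x)) -> bicircular_projection P).
  { intros P c m HP Hc Hm Hm1 HE. split; [easy|]. exists m. repeat split; try easy.
    - intros x y. rewrite !HE. now apply (surjective_isometry_scal c _ Hc HTT).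
    - intros y. destruct (proj2 (surjective_isometry_scal c _ Hc HTT) y) as [x Hx].
      exists x. now rewrite HE. }
  (* For the roots [1], [l1], [l2] the elementary symmetric functions satisfy [e1 e2 - e3 =] the
     product of the pairwise sums. *)
  assert (F : ((1 + l1) * ((1 + l2) * (l1 + l2)) = 0)%C).
  { replace ((1 + l1) * ((1 + l2) * (l1 + l2)))%C with
      ((1 + l1 + l2) * (l1 + l2 + l1 * l2) - l1 * l2)%C by ring. rewrite E. ring. }
  assert (Mq : forall a : C, Cmod a = 1 -> Cmod (a * a) = 1)
    by (intros a Ha; rewrite Cmod_mult, Ha; ring).
  assert (Nz : forall a : C, Cmod a = 1 -> a <> RtoC 0)
    by (intros a Ha ->; rewrite Cmod_0 in Ha; lra).
  assert (Inv : forall a : C, Cmod a = 1 -> a <> RtoC 1 -> Cmod (/ a) = 1 /\ (/ a)%C <> RtoC 1).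
  { intros a Ha Ha1. split; [rewrite Cmod_inv, Ha by auto; apply Rinv_1|].
    intros H. apply Ha1. rewrite <- (Cinv_r a) by auto. rewrite H. ring. }
  destruct hP as [[H0 [H1 H2]] _].
  apply Hint in F. destruct F as [F|F]; [|apply Hint in F; destruct F as [F|F]].
  - assert (El1 : l1 = (- (1))%C) by (replace l1 with (1 + l1 - 1)%C by ring; rewrite F; ring).
    (* A square equal to [1] would give [l2 = 1] or [l2 = -1 = l1], both excluded. *)
    assert (Hne : (l2 * l2)%C <> RtoC 1) by (intros H; apply Hsq in H; destruct H; congruence).
    destruct (Inv (l2 * l2)%C) as [Ia Ib]; auto.
    right; right. apply (Hbi P2 (/ (l2 * l2))%C (/ (l2 * l2))%C); auto.
    intros x. rewrite tri_comb_lin3, lin3_scal. unfold minus.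
    transitivity (plus (lin3 (P0 x) (P1 x) (P2 x) 0 0 1)
      (scal (/ (l2 * l2) : C_AbsRing)%C (plus (lin3 (P0 x) (P1 x) (P2 x) 1 1 1)
        (opp (lin3 (P0 x) (P1 x) (P2 x) 0 0 1))))).
    + rewrite <- family_sum. unfold lin3. change (RtoC 0) with (zero : C_Ring).
      change (RtoC 1) with (one : C_Ring). now rewrite !scal_zero_l, !plus_zero_l, scal_one.
    + rewrite lin3_opp, lin3_plus, lin3_scal, lin3_plus. rewrite El1. f_equal; field; auto.
  - assert (El2 : l2 = (- (1))%C) by (replace l2 with (1 + l2 - 1)%C by ring; rewrite F; ring).
    assert (Hne : (l1 * l1)%C <> RtoC 1) by (intros H; apply Hsq in H; destruct H; congruence).
    destruct (Inv (l1 * l1)%C) as [Ia Ib]; auto.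
    right; left. apply (Hbi P1 (/ (l1 * l1))%C (/ (l1 * l1))%C); auto.
    intros x. rewrite tri_comb_lin3, lin3_scal. unfold minus.
    transitivity (plus (lin3 (P0 x) (P1 x) (P2 x) 0 1 0)
      (scal (/ (l1 * l1) : C_AbsRing)%C (plus (lin3 (P0 x) (P1 x) (P2 x) 1 1 1)
        (opp (lin3 (P0 x) (P1 x) (P2 x) 0 1 0))))).
    + rewrite <- family_sum. unfold lin3. change (RtoC 0) with (zero : C_Ring).
      change (RtoC 1) with (one : C_Ring). now rewrite !scal_zero_l, plus_zero_l, plus_zero_r, scal_one.
    + rewrite lin3_opp, lin3_plus, lin3_scal, lin3_plus. rewrite El2. f_equal; field; auto.
  - assert (El2 : l2 = (- l1)%C) by (replace l2 with (l1 + l2 - l1)%C by ring; rewrite F; ring).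
    (* Here [l1 = -1] would force [l2 = -l1 = 1]. *)
    assert (Hne : (l1 * l1)%C <> RtoC 1).
    { intros H. apply Hsq in H. destruct H as [H|H]; [easy|]. apply N2. rewrite El2, H. ring. }
    left. apply (Hbi P0 (RtoC 1) (l1 * l1)%C); auto; [apply Cmod_1|].
    intros x. rewrite tri_comb_lin3, lin3_scal. unfold minus.
    transitivity (plus (lin3 (P0 x) (P1 x) (P2 x) 1 0 0)
      (scal (l1 * l1 : C_AbsRing)%C (plus (lin3 (P0 x) (P1 x) (P2 x) 1 1 1)
        (opp (lin3 (P0 x) (P1 x) (P2 x) 1 0 0))))).
    + rewrite <- family_sum. unfold lin3. change (RtoC 0) with (zero : C_Ring).
      change (RtoC 1) with (one : C_Ring). now rewrite !scal_zero_l, !plus_zero_r, scal_one.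
    + rewrite lin3_opp, lin3_plus, lin3_scal, lin3_plus. rewrite El2. f_equal; ring.
Qed.

End Family.

Lemma Cmod_1_conj (a : C) : Cmod a = 1 -> (Cconj a * a = 1)%C.
Proof.
  intros H. rewrite Cmult_comm, <- Cmod2_conj, H. unfold RtoC. f_equal; ring.
Qed.

(** * Orthogonality of eigenvectors of isometries of a Hilbert space *)

Section Orthogonality.
Context {K : CompleteNormedModule C_AbsRing} {ip : K -> K -> C} (hip : is_inner_product ip).

Lemma ip_plus_r x y z : ip x (plus y z) = (ip x y + ip x z)%C.
Proof.
  rewrite (ip_sym _ hip), (ip_plus _ hip), Cplus_conj, <- !(ip_sym _ hip). reflexivity.
Qed.

Lemma ip_scal_r (a : C) x y : ip x (scal (a : C_AbsRing) y) = (Cconj a * ip x y)%C.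
Proof.
  rewrite (ip_sym _ hip), (ip_scal _ hip), Cmult_conj, <- (ip_sym _ hip). reflexivity.
Qed.

Lemma ip_self_zero x : ip x x = RtoC 0 -> x = zero.
Proof.
  rewrite (ip_norm _ hip). intros E. apply RtoC_inj in E.
  apply (@norm_eq_zero C_AbsRing K). apply Rsqr_0_uniq. unfold Rsqr. rewrite <- E. ring.
Qed.

Lemma isometry_norm (W : K -> K) x : (forall u v, ip (W u) (W v) = ip u v) -> norm (W x) = norm x.
Proof.
  intros HW. pose proof (HW x x) as E. rewrite !(ip_norm _ hip) in E. apply RtoC_inj in E.
  apply Rsqr_inj; try apply norm_ge_0. unfold Rsqr. simpl in E. lra.
Qed.

(** Preservation of the inner product gives [<x, y> = a conj(b) <x, y>]; if [<x, y>] were nonzero,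
    then [a conj(b) = 1], hence [a = b] because [|b| = 1]. *)
Lemma isometry_eigen_orthogonal (W : K -> K) (x y : K) (a b : C) :
  (forall u v, ip (W u) (W v) = ip u v) -> Cmod b = 1 -> a <> b ->
  W x = scal (a : C_AbsRing) x -> W y = scal (b : C_AbsRing) y -> ip x y = RtoC 0.
Proof.
  intros HW Hb Hab Hx Hy. pose proof (HW x y) as E.
  rewrite Hx, Hy, (ip_scal _ hip), ip_scal_r in E.
  destruct (Ceq_dec (ip x y) (RtoC 0)) as [|N]; [easy|exfalso]. apply Hab.
  pose proof (Cmod_1_conj b Hb) as Hc.
  transitivity (a * (Cconj b * ip x y) * / ip x y * b)%C.
  - transitivity (a * (Cconj b * b))%C; [rewrite Hc; ring|field; easy].
  - rewrite E. field. easy.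
Qed.

(** Pythagoras: the cross terms vanish, and the squared norm is the sum of those of the three
    vectors for any unimodular coefficients. *)
Lemma norm_lin3_orthogonal (y0 y1 y2 : K) (a b c : C) :
  ip y0 y1 = RtoC 0 -> ip y0 y2 = RtoC 0 -> ip y1 y2 = RtoC 0 ->
  Cmod a = 1 -> Cmod b = 1 -> Cmod c = 1 ->
  norm (lin3 y0 y1 y2 a b c : K) = norm (lin3 y0 y1 y2 (RtoC 1) (RtoC 1) (RtoC 1) : K).
Proof.
  intros H01 H02 H12 Ha Hb Hc.
  assert (H10 : ip y1 y0 = RtoC 0) by (rewrite (ip_sym _ hip), H01; unfold Cconj, RtoC; simpl; f_equal; ring).
  assert (H20 : ip y2 y0 = RtoC 0) by (rewrite (ip_sym _ hip), H02; unfold Cconj, RtoC; simpl; f_equal; ring).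
  assert (H21 : ip y2 y1 = RtoC 0) by (rewrite (ip_sym _ hip), H12; unfold Cconj, RtoC; simpl; f_equal; ring).
  assert (Q : forall a b c : C, Cmod a = 1 -> Cmod b = 1 -> Cmod c = 1 ->
    ip (lin3 y0 y1 y2 a b c) (lin3 y0 y1 y2 a b c) = (ip y0 y0 + ip y1 y1 + ip y2 y2)%C).
  { clear a b c Ha Hb Hc. intros a b c Ha Hb Hc. unfold lin3.
    rewrite !(ip_plus _ hip), !ip_plus_r, !(ip_scal _ hip), !ip_scal_r.
    rewrite H01, H02, H12, H10, H20, H21.
    transitivity ((Cconj a * a) * ip y0 y0 + (Cconj b * b) * ip y1 y1 + (Cconj c * c) * ip y2 y2)%C; [ring|].
    rewrite !Cmod_1_conj by easy. ring. }
  assert (E : ip (lin3 y0 y1 y2 a b c) (lin3 y0 y1 y2 a b c) =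
    ip (lin3 y0 y1 y2 (RtoC 1) (RtoC 1) (RtoC 1)) (lin3 y0 y1 y2 (RtoC 1) (RtoC 1) (RtoC 1)))
    by (rewrite !Q; auto using Cmod_1).
  rewrite !(ip_norm _ hip) in E. apply RtoC_inj in E.
  apply Rsqr_inj; try apply norm_ge_0. unfold Rsqr. simpl in E. rewrite !Rmult_1_r in E. exact E.
Qed.

Lemma isometry_spectral_norm (W : K -> K) (y0 y1 y2 : K) (l1 l2 m1 m2 : C) :
  (forall u v, ip (W u) (W v) = ip u v) -> Cmod l1 = 1 -> Cmod l2 = 1 ->
  l1 <> RtoC 1 -> l2 <> RtoC 1 -> l1 <> l2 ->
  W y0 = scal (RtoC 1 : C_AbsRing) y0 -> W y1 = scal (l1 : C_AbsRing) y1 ->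
  W y2 = scal (l2 : C_AbsRing) y2 -> Cmod m1 = 1 -> Cmod m2 = 1 ->
  norm (lin3 y0 y1 y2 (RtoC 1) m1 m2 : K) = norm (lin3 y0 y1 y2 (RtoC 1) (RtoC 1) (RtoC 1) : K).
Proof.
  intros HW M1 M2 N1 N2 N12 E0 E1 E2 Hm1 Hm2.
  apply norm_lin3_orthogonal; auto using Cmod_1.
  - now apply (isometry_eigen_orthogonal W _ _ (RtoC 1) l1); auto.
  - now apply (isometry_eigen_orthogonal W _ _ (RtoC 1) l2); auto.
  - now apply (isometry_eigen_orthogonal W _ _ l1 l2); auto.
Qed.

(** An eigenvector for any other [mu] would be orthogonal to each of the three summands, hence to
    itself. *)
Lemma isometry_spectrum (W : K -> K) (x y0 y1 y2 : K) (l1 l2 mu : C) :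
  (forall u v, ip (W u) (W v) = ip u v) -> Cmod l1 = 1 -> Cmod l2 = 1 ->
  W y0 = scal (RtoC 1 : C_AbsRing) y0 -> W y1 = scal (l1 : C_AbsRing) y1 ->
  W y2 = scal (l2 : C_AbsRing) y2 -> x = plus (plus y0 y1) y2 -> x <> zero ->
  W x = scal (mu : C_AbsRing) x -> mu = RtoC 1 \/ mu = l1 \/ mu = l2.
Proof.
  intros HW M1 M2 E0 E1 E2 Ex Nx Emu.
  destruct (Ceq_dec mu (RtoC 1)) as [|D0]; [now left|].
  destruct (Ceq_dec mu l1) as [|D1]; [now right; left|].
  destruct (Ceq_dec mu l2) as [|D2]; [now right; right|].
  exfalso. apply Nx, ip_self_zero. rewrite Ex at 2. rewrite !ip_plus_r.
  rewrite (isometry_eigen_orthogonal W x y0 mu (RtoC 1)), (isometry_eigen_orthogonal W x y1 mu l1),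
    (isometry_eigen_orthogonal W x y2 mu l2); auto using Cmod_1. ring.
Qed.

Lemma unitary_neq_0 (U : K -> K) x : unitary ip U -> x <> zero -> U x <> zero.
Proof.
  intros [_ [H _]] Nx E. apply Nx, (@norm_eq_zero C_AbsRing K).
  rewrite <- (isometry_norm U x H), E. exact (@norm_zero C_AbsRing K).
Qed.

End Orthogonality.

(** * The branch [g] when [phi] is the identity *)

Section IdentityBranch.
Context {p : R} {phi g : C -> C} (hg : power_branch p phi g)
  (hid : forall z, Cmod z < 1 -> phi z = z).

Lemma identity_branch_log : exists L : C -> C, analytic_C L /\
  forall z, Cmod z < 1 -> Cexp (L z) = RtoC 1 /\ g z = Cexp (RtoC (/ p) * L z)%C.
Proof.
  destruct hg as [L [HL H]]. exists L. split; [easy|]. intros z Hz.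
  destruct (H z Hz) as [E1 E2]. split; [|easy]. rewrite E1. apply is_C_derive_unique.
  apply (is_derive_ext_loc (fun w : C => w)).
  - eapply filter_imp; [|now apply locally_disk]. intros w Hw. symmetry. now apply hid.
  (* The derivative of the identity is taken apart and rebuilt over the module structure of the
     goal. *)
  - destruct (is_derive_id (K := C_AbsRing) z) as [[H1 H2 H3] H4].
    split; [split; [exact H1|exact H2|exact H3]|exact H4].
Qed.

Lemma Cexp_eq_1 (w : C) : Cexp w = RtoC 1 -> fst w = 0 /\ sin (snd w) = 0 /\ cos (snd w) = 1.
Proof.
  unfold Cexp, RtoC. intros E. injection E as E1 E2. pose proof (exp_pos (fst w)) as He.
  assert (Hs : sin (snd w) = 0) by (apply Rmult_integral in E2; destruct E2; lra).
  pose proof (sin2_cos2 (snd w)) as H2. unfold Rsqr in H2. rewrite Hs in H2.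
  (* The square of the cosine is [1], and its product with a positive exponential is [1], which
     excludes [-1]. *)
  assert (Hc : cos (snd w) = 1) by nra.
  rewrite Hc, Rmult_1_r in E1. split; [|easy].
  rewrite <- (ln_exp (fst w)), E1. apply ln_1.
Qed.

(** The logarithm [L] of the constant derivative [1] is purely imaginary, and so is [L / p]. *)
Lemma Cmod_identity_branch (z : C) : Cmod z < 1 -> Cmod (g z) = 1.
Proof.
  destruct identity_branch_log as [L [_ H]]. intros Hz. destruct (H z Hz) as [E1 ->].
  apply Cexp_eq_1 in E1. destruct E1 as [E1 _]. unfold Cexp.
  replace (fst (RtoC (/ p) * L z)%C) with 0.
  - rewrite exp_0. apply (Cmod_polar 1). lra.
  - unfold Cmult, RtoC; simpl. rewrite E1. ring.
Qed.

(** Along the ray to [z] the imaginary part [u] of [L] satisfies [sin u = 0] and [cos u = 1].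
    Differentiating the first identity gives [u' cos u = 0], so [u' = 0] and [L] has the same value
    at both ends. *)
Lemma identity_branch_constant (z : C) : Cmod z < 1 -> g z = g (RtoC 0).
Proof.
  intros Hz. destruct identity_branch_log as [L [HL H]].
  assert (H0 : Cmod (RtoC 0) < 1) by (rewrite Cmod_0; lra).
  rewrite (proj2 (H z Hz)), (proj2 (H _ H0)). f_equal. f_equal.
  destruct (Cexp_eq_1 _ (proj1 (H z Hz))) as [Ez _]. destruct (Cexp_eq_1 _ (proj1 (H _ H0))) as [E0 _].
  rewrite (surjective_pairing (L z)), (surjective_pairing (L (RtoC 0))), Ez, E0. f_equal.
  set (u := fun t : R => snd (L (RtoC t * z)%C)).
  assert (E : u 0 = u 1).
  { apply (eq_is_derive (V := R_NormedModule) u); [|lra]. intros t Ht.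
    assert (Htz : Cmod (RtoC t * z) < 1) by (apply Cmod_radial; lra).
    destruct (HL _ Htz) as [l Hl].
    pose proof (is_derive_radial (K := C_CompleteNormedModule) L z t l Hl) as D.
    set (d := snd (scal (z : C_AbsRing) (l : C_NormedModule) : C)).
    assert (Du : is_derive u t d).
    { apply (filterdiff_ext_lin (V := R_NormedModule) _
        (fun y : R => snd (real_scal C_CompleteNormedModule y (scal (z : C_AbsRing) (l : C_NormedModule))))).
      - apply (filterdiff_comp' (K := R_AbsRing) (V := realify C_CompleteNormedModule) (W := R_NormedModule)
          (fun t : R => L (RtoC t * z)%C) snd); [exact D|].
        apply (filterdiff_linear (K := R_AbsRing)). split.
        + reflexivity.
        + intros a [x y]. unfold scal; simpl; unfold mult; simpl. ring.
        + exists 1. split; [lra|]. intros [x y]. rewrite Rmult_1_l.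
          change (Rabs y <= Cmod (x, y)). eapply Rle_trans; [|apply Rmax_Cmod]. apply Rmax_r.
      - intros y. unfold d. destruct (scal (z : C_AbsRing) (l : C_NormedModule)) as [a b].
        unfold real_scal, scal; simpl; unfold mult; simpl. ring. }
    assert (Es : locally t (fun s : R => sin (u s) = 0)).
    { pose proof (continuous_ray z t _ (locally_disk _ Htz)) as Hl'.
      eapply filter_imp; [|exact Hl']. intros s Hs. apply (Cexp_eq_1 (L (RtoC s * z)%C)). now apply H. }
    assert (Ds : is_derive (fun s => sin (u s)) t (scal d (cos (u t)))).
    { apply (is_derive_comp sin u); [|exact Du]. apply is_derive_Reals. apply derivable_pt_lim_sin. }
    assert (D0 : is_derive (fun s => sin (u s)) t 0).
    { apply (is_derive_ext_loc (fun _ => 0)); [|exact (is_derive_const (K := R_AbsRing) (V := R_NormedModule) 0 t)].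
      eapply filter_imp; [|exact Es]. intros s Hs. now symmetry. }
    apply is_derive_unique in Ds. apply is_derive_unique in D0. rewrite D0 in Ds.
    destruct (Cexp_eq_1 _ (proj1 (H _ Htz))) as [_ [_ Ec]].
    unfold u in Ds at 1. rewrite Ec in Ds. unfold scal in Ds; simpl in Ds; unfold mult in Ds; simpl in Ds.
    rewrite Rmult_1_r in Ds. rewrite <- Ds in Du. exact Du. }
  unfold u in E. replace (RtoC 1 * z)%C with z in E by ring. replace (RtoC 0 * z)%C with (RtoC 0) in E by ring.
  now symmetry.
Qed.

End IdentityBranch.

(** * Cancellation lemmas and derivatives of elements of [Sp] *)

Lemma Hp_norm_ext_norm {V : NormedModule C_AbsRing} (p : R) (f h : C -> V) :
  (forall z, Cmod z < 1 -> norm (f z) = norm (h z)) -> Hp_norm p f = Hp_norm p h.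
Proof.
  intros E. unfold Hp_norm. f_equal. apply Lub_Rbar_eqset. intros m.
  assert (Em : forall r, 0 <= r < 1 -> Hp_mean p f r = Hp_mean p h r).
  { intros r Hr. unfold Hp_mean. f_equal. apply functional_extensionality.
    intros t. apply E. rewrite Cmod_polar; lra. }
  split; intros [r [Hr ->]]; exists r; split; auto. symmetry; auto.
Qed.

Lemma disk_0 : Cmod (RtoC 0) < 1.
Proof. rewrite Cmod_0. lra. Qed.

Lemma Cminus_neq_0 (a b : C) : a <> b -> (a - b)%C <> RtoC 0.
Proof. intros N E. apply N. replace a with (a - b + b)%C by ring. rewrite E. ring. Qed.

Lemma Cmult_eq_0_l (a b : C) : (a * b)%C = RtoC 0 -> b <> RtoC 0 -> a = RtoC 0.
Proof.
  intros E Nb. destruct (Ceq_dec a (RtoC 0)) as [|Na]; [easy|]. exfalso. now apply (Cmult_neq_0 a b).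
Qed.

(** Serves to isolate one term of the cubic relation when the roots of the test function remove the
    other three. *)
Lemma plus4_only {X : AbelianGroup} (a b c d : X) : plus (plus a b) (plus c d) = zero ->
  (b = zero -> c = zero -> d = zero -> a = zero) /\ (a = zero -> c = zero -> d = zero -> b = zero) /\
  (a = zero -> b = zero -> d = zero -> c = zero) /\ (a = zero -> b = zero -> c = zero -> d = zero).
Proof.
  intros E. repeat split; intros H1 H2 H3; rewrite H1, H2, H3 in E;
    rewrite ?plus_zero_l, ?plus_zero_r in E; exact E.
Qed.

Lemma scal_zero_coef {X : NormedModule C_AbsRing} (a : C) (x : X) :
  a = RtoC 0 -> scal (a : C_AbsRing) x = zero.
Proof. intros ->. exact (@scal_zero_l C_Ring X x). Qed.

(** A function with zero derivative on the disk is constant there, so the value at [0] and the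
    derivative together detect every element. *)
Lemma Sp_neq_zero {K : CompleteNormedModule C_AbsRing} {p : R} {hp : 1 <= p} (f : Sp K hp) :
  f <> zero -> Sp_val f (RtoC 0) <> zero \/ exists z, Cmod z < 1 /\ hderiv (Sp_val f) z <> zero.
Proof.
  intros Nf. apply NNPP. intros H. apply Nf.
  assert (H0 : Sp_val f (RtoC 0) = zero) by (apply NNPP; intros N; apply H; now left).
  assert (H1 : forall z, Cmod z < 1 -> hderiv (Sp_val f) z = zero).
  { intros z Hz. apply NNPP; intros N; apply H; right. now exists z. }
  apply (Sp_eq K p f (Sp_zero K p hp)). intros z Hz.
  rewrite (analytic_deriv_zero (Sp_val f) (Sp_analytic _ _ f) H1 z Hz). exact H0.
Qed.

Section Derivatives.
Context {K : CompleteNormedModule C_AbsRing} {p : R} {hp : 1 <= p}.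

Lemma Sp_hderiv_plus (f h : Sp K hp) z : Cmod z < 1 ->
  hderiv (Sp_val (plus f h)) z = plus (hderiv (Sp_val f) z) (hderiv (Sp_val h) z).
Proof. intros Hz. exact (hderiv_plus _ _ z (Sp_analytic _ _ f) (Sp_analytic _ _ h) Hz). Qed.

Lemma Sp_hderiv_scal (a : C) (f : Sp K hp) z : Cmod z < 1 ->
  hderiv (Sp_val (scal (a : C_AbsRing) f)) z = scal (a : C_AbsRing) (hderiv (Sp_val f) z).
Proof. intros Hz. exact (hderiv_scal a _ z (Sp_analytic _ _ f) Hz). Qed.

Lemma Sp_hderiv_lin3 (f0 f1 f2 : Sp K hp) a b c z : Cmod z < 1 ->
  hderiv (Sp_val (lin3 f0 f1 f2 a b c : Sp K hp)) z =
  lin3 (hderiv (Sp_val f0) z) (hderiv (Sp_val f1) z) (hderiv (Sp_val f2) z) a b c.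
Proof.
  intros Hz. unfold lin3.
  etransitivity; [exact (Sp_hderiv_plus _ _ z Hz)|]. f_equal; [|exact (Sp_hderiv_scal c f2 z Hz)].
  etransitivity; [exact (Sp_hderiv_plus _ _ z Hz)|].
  f_equal; [exact (Sp_hderiv_scal a f0 z Hz)|exact (Sp_hderiv_scal b f1 z Hz)].
Qed.

Lemma Sp_val_lin3 (f0 f1 f2 : Sp K hp) a b c z :
  Sp_val (lin3 f0 f1 f2 a b c : Sp K hp) z = lin3 (Sp_val f0 z) (Sp_val f1 z) (Sp_val f2 z) a b c.
Proof. reflexivity. Qed.

End Derivatives.

(** * The cubic relation along orbits of [phi] *)

Section Main.
Context {K : CompleteNormedModule C_AbsRing} {ip : K -> K -> C} (hip : is_inner_product ip)
  {p : R} {hp : 1 <= p} {P0 P1 P2 : Sp K hp -> Sp K hp} (hP : proj_family P0 P1 P2)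
  {l1 l2 : C} (hl1 : Cmod l1 = 1) (hl2 : Cmod l2 = 1)
  (hl1' : l1 <> RtoC 1) (hl2' : l2 <> RtoC 1) (hl12 : l1 <> l2)
  {U V : K -> K} (hU : unitary ip U) (hV : unitary ip V)
  {phi : C -> C} (hphi : disk_automorphism phi)
  {g : C -> C} (hg : power_branch p phi g)
  (hform : forall (f : Sp K hp) (z : C), Cmod z < 1 ->
     Sp_val (tri_comb P0 P1 P2 l1 l2 f) z =
     plus (V (Sp_val f (RtoC 0)))
       (U (integral_0
            (fun xi : C => scal (g xi : C_AbsRing) (hderiv (Sp_val f) (phi xi))) z))).

Local Notation T := (tri_comb P0 P1 P2 l1 l2).

Lemma T_at_0 (f : Sp K hp) : Sp_val (T f) (RtoC 0) = V (Sp_val f (RtoC 0)).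
Proof.
  rewrite hform by apply disk_0.
  assert (E : integral_0 (fun xi : C => scal (g xi : C_AbsRing) (hderiv (Sp_val f) (phi xi))) (RtoC 0) = zero).
  { unfold integral_0. etransitivity; [apply (RInt_ext (V := realify K) _ (fun _ => zero))|].
    - intros t _. exact (@scal_zero_l C_Ring K _).
    - rewrite RInt_const. exact (@scal_zero_r R_Ring (realify K) (1 - 0)). }
  rewrite E.
  assert (E0 : U zero = zero).
  { rewrite <- (@scal_zero_l C_Ring K zero) at 1.
    etransitivity; [exact (linear_scal U (proj1 hU) (RtoC 0) zero)|]. exact (@scal_zero_l C_Ring K _). }
  rewrite E0. apply plus_zero_r.
Qed.

(** On derivatives [T] becomes a weighted composition, which can be iterated pointwise. *)
Lemma T_hderiv (f : Sp K hp) (z : C) : Cmod z < 1 ->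
  hderiv (Sp_val (T f)) z = scal (g z : C_AbsRing) (U (hderiv (Sp_val f) (phi z))).
Proof.
  intros Hz.
  rewrite (hderiv_integral (Sp_val (T f)) (fun xi => scal (g xi : C_AbsRing) (hderiv (Sp_val f) (phi xi)))
    (V (Sp_val f (RtoC 0))) U).
  - exact (linear_scal U (proj1 hU) (g z) _).
  - intros w Hw. apply (continuous_weighted_composition hphi hg); [apply (Sp_hardy _ _ f)|easy].
  - apply hU.
  - apply (Sp_analytic _ _ (T f)).
  - apply (Sp_hardy _ _ (T f)).
  - intros w Hw. now apply hform.
  - easy.
Qed.

Lemma T2_hderiv (f : Sp K hp) (z : C) : Cmod z < 1 ->
  hderiv (Sp_val (T (T f))) z =
  scal (g z * g (phi z) : C_AbsRing)%C (U (U (hderiv (Sp_val f) (phi (phi z))))).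
Proof.
  intros Hz. rewrite T_hderiv, T_hderiv by (try apply (automorphism_disk hphi); easy).
  rewrite (linear_scal U (proj1 hU)), (@scal_assoc C_AbsRing K). reflexivity.
Qed.

Lemma T3_hderiv (f : Sp K hp) (z : C) : Cmod z < 1 ->
  hderiv (Sp_val (T (T (T f)))) z =
  scal (g z * (g (phi z) * g (phi (phi z))) : C_AbsRing)%C
    (U (U (U (hderiv (Sp_val f) (phi (phi (phi z))))))).
Proof.
  intros Hz. rewrite T_hderiv, T2_hderiv by (try apply (automorphism_disk hphi); easy).
  rewrite (linear_scal U (proj1 hU)), (@scal_assoc C_AbsRing K). reflexivity.
Qed.

(** The cubic relation of [T], differentiated at [z] on a test function with derivative [e x]: the
    [k]-th power of [T] contributes [U^k x], weighted by the values of [g] along the orbit and by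
    [e (phi^k z)]. *)
Lemma test_relation (x : K) (c0 c1 c2 c3 z : C) (e := cubic c0 c1 c2 c3) : Cmod z < 1 ->
  plus (plus
    (scal (g z * (g (phi z) * g (phi (phi z))) * e (phi (phi (phi z))) : C_AbsRing)%C (U (U (U x))))
    (scal (- (1 + l1 + l2) * (g z * g (phi z)) * e (phi (phi z)) : C_AbsRing)%C (U (U x))))
  (plus (scal ((l1 + l2 + l1 * l2) * g z * e (phi z) : C_AbsRing)%C (U x))
    (scal (- (l1 * l2) * e z : C_AbsRing)%C x)) = zero.
Proof.
  intros Hz. destruct (Sp_cubic hp zero x c0 c1 c2 c3) as [f [_ Hf]].
  assert (Hz1 := automorphism_disk hphi z Hz). assert (Hz2 := automorphism_disk hphi _ Hz1).
  assert (Hz3 := automorphism_disk hphi _ Hz2).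
  pose proof (tri_comb_cubic_relation hP l1 l2 f) as E. cbv zeta in E.
  apply (f_equal (fun h : Sp K hp => hderiv (Sp_val h) z)) in E.
  assert (E' : plus (plus (hderiv (Sp_val (T (T (T f)))) z)
      (scal (- (1 + l1 + l2) : C_AbsRing)%C (hderiv (Sp_val (T (T f))) z)))
    (plus (scal (l1 + l2 + l1 * l2 : C_AbsRing)%C (hderiv (Sp_val (T f)) z))
      (scal (- (l1 * l2) : C_AbsRing)%C (hderiv (Sp_val f) z))) = zero).
  { etransitivity; [|etransitivity; [exact E|exact (hderiv_zero z)]].
    symmetry. etransitivity; [exact (Sp_hderiv_plus _ _ z Hz)|]. f_equal.
    - etransitivity; [exact (Sp_hderiv_plus _ _ z Hz)|]. f_equal. exact (Sp_hderiv_scal _ _ z Hz).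
    - etransitivity; [exact (Sp_hderiv_plus _ _ z Hz)|]. f_equal; exact (Sp_hderiv_scal _ _ z Hz). }
  rewrite T3_hderiv, T2_hderiv, T_hderiv, !Hf in E' by easy.
  rewrite !(linear_scal U (proj1 hU)), !(@scal_assoc C_AbsRing K) in E'. exact E'.
Qed.

(* The test function [(w - a) (w - b) (w - c) x] annihilates the terms of [test_relation]
   at which it vanishes. *)
Lemma root_relation (x : K) (a b c z : C) (e := fun w => ((w - a) * (w - b) * (w - c))%C) : Cmod z < 1 ->
  plus (plus
    (scal (g z * (g (phi z) * g (phi (phi z))) * e (phi (phi (phi z))) : C_AbsRing)%C (U (U (U x))))
    (scal (- (1 + l1 + l2) * (g z * g (phi z)) * e (phi (phi z)) : C_AbsRing)%C (U (U x))))
  (plus (scal ((l1 + l2 + l1 * l2) * g z * e (phi z) : C_AbsRing)%C (U x))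
    (scal (- (l1 * l2) * e z : C_AbsRing)%C x)) = zero.
Proof.
  intros Hz. pose proof (test_relation x (- (a * b * c)) (a * b + b * c + c * a) (- (a + b + c)) 1 z Hz) as H.
  cbv zeta in H.
  assert (E : forall w, cubic (- (a * b * c)) (a * b + b * c + c * a) (- (a + b + c)) 1 w = e w)
    by (intros w; unfold cubic, e; ring).
  rewrite !E in H. exact H.
Qed.

#[local] Hint Resolve automorphism_disk : core.

Lemma lambda_neq_0 : l1 <> RtoC 0 /\ l2 <> RtoC 0.
Proof. split; intros E; [rewrite E, Cmod_0 in hl1|rewrite E, Cmod_0 in hl2]; lra. Qed.

Lemma unitary_nonzero (x : K) : x <> zero -> U x <> zero /\ U (U x) <> zero.
Proof. intros Nx. split; repeat apply (unitary_neq_0 hip U); auto. Qed.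

(** Each choice of roots on the orbit leaves a single term of the relation, whose scalar coefficient
    must vanish since [U] is injective and [x] is nonzero. *)
Lemma distinct_orbit (x : K) (z : C) : x <> zero -> Cmod z < 1 ->
  z <> phi z -> z <> phi (phi z) ->
  (1 + l1 + l2 = 0)%C /\ (l1 + l2 + l1 * l2 = 0)%C.
Proof.
  intros Nx Hz N1 N2.
  assert (N3 : phi z <> phi (phi z)) by (intros E; apply N1, (automorphism_inj hphi); auto).
  destruct (unitary_nonzero x Nx) as [NU NUU]. destruct lambda_neq_0 as [L1 L2].
  assert (G0 : forall w, Cmod w < 1 -> g w <> RtoC 0) by exact (branch_neq_0 hg).
  assert (E3 : phi (phi (phi z)) = z).
  { apply NNPP. intros N.
    (* Roots at the three later points leave only the term in [x]; its coefficient is nonzero as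
       long as [phi^3 z] differs from [z]. *)
    pose proof (root_relation x (phi z) (phi (phi z)) (phi (phi (phi z))) z Hz) as H. cbv zeta beta in H.
    apply (@plus4_only K) in H. destruct H as [_ [_ [_ H]]].
    destruct (@scal_C_eq_zero K _ _ (H ltac:(apply (@scal_zero_coef K); ring) ltac:(apply (@scal_zero_coef K); ring)
      ltac:(apply (@scal_zero_coef K); ring))) as [H'|]; [|contradiction].
    revert H'. repeat apply Cmult_neq_0; try apply Cminus_neq_0; auto.
    intros E. apply (Cmult_neq_0 l1 l2 L1 L2). replace (l1 * l2)%C with (- - (l1 * l2))%C by ring.
    rewrite E. ring. }
  split.
  (* Since [phi^3 z = z], a root at [z] removes both outer terms; a root at [phi z] then leaves the
     [T^2] term. The root at [z] is doubled only to fill the degree. *)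
  - pose proof (root_relation x z z (phi z) z Hz) as H. cbv zeta beta in H. rewrite E3 in H.
    apply (@plus4_only K) in H. destruct H as [_ [H _]].
    destruct (@scal_C_eq_zero K _ _ (H ltac:(apply (@scal_zero_coef K); ring) ltac:(apply (@scal_zero_coef K); ring)
      ltac:(apply (@scal_zero_coef K); ring))) as [H'|]; [|contradiction].
    apply Cmult_eq_0_l in H'; [|repeat apply Cmult_neq_0; try apply Cminus_neq_0; auto].
    apply Cmult_eq_0_l in H'; [|apply Cmult_neq_0; auto].
    replace (1 + l1 + l2)%C with (- - (1 + l1 + l2))%C by ring. rewrite H'. ring.
  (* With the simple root moved to [phi^2 z], the [T] term is left. *)
  - pose proof (root_relation x z z (phi (phi z)) z Hz) as H. cbv zeta beta in H. rewrite E3 in H.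
    apply (@plus4_only K) in H. destruct H as [_ [_ [H _]]].
    destruct (@scal_C_eq_zero K _ _ (H ltac:(apply (@scal_zero_coef K); ring) ltac:(apply (@scal_zero_coef K); ring)
      ltac:(apply (@scal_zero_coef K); ring))) as [H'|]; [|contradiction].
    apply Cmult_eq_0_l in H'; [|repeat apply Cmult_neq_0; try apply Cminus_neq_0; auto].
    apply Cmult_eq_0_l in H'; auto.
Qed.

(** On a two-point orbit a triple root at [phi z] keeps the even powers of [T] and one at [z] the
    odd powers. This gives two linear equations between [U^2 x] and [x], and eliminating [U^2 x]
    yields the scalar relation. *)
Lemma involutive_orbit (x : K) (z : C) : x <> zero -> Cmod z < 1 ->
  z <> phi z -> phi (phi z) = z -> ((1 + l1 + l2) * (l1 + l2 + l1 * l2) = l1 * l2)%C.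
Proof.
  intros Nx Hz N1 E2.
  assert (Hz' := automorphism_disk hphi z Hz).
  assert (G0 : forall w, Cmod w < 1 -> g w <> RtoC 0) by exact (branch_neq_0 hg).
  pose proof (root_relation x (phi z) (phi z) (phi z) z Hz) as H. cbv zeta beta in H. rewrite !E2 in H.
  pose proof (root_relation x z z z z Hz) as H'. cbv zeta beta in H'. rewrite !E2 in H'.
  set (s1 := (1 + l1 + l2)%C) in *. set (s2 := (l1 + l2 + l1 * l2)%C) in *. set (s3 := (l1 * l2)%C) in *.
  set (c := (g z * g (phi z))%C).
  assert (Nd : ((z - phi z) * (z - phi z) * (z - phi z))%C <> RtoC 0)
    by (repeat apply Cmult_neq_0; apply Cminus_neq_0; auto).
  assert (Nd' : ((phi z - z) * (phi z - z) * (phi z - z))%C <> RtoC 0)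
    by (repeat apply Cmult_neq_0; apply Cminus_neq_0; auto).
  set (d := ((z - phi z) * (z - phi z) * (z - phi z))%C) in *.
  set (d' := ((phi z - z) * (phi z - z) * (phi z - z))%C) in *.
  assert (A1 : plus (scal (s1 * c : C_AbsRing)%C (U (U x))) (scal (s3 : C_AbsRing) x) = zero).
  { assert (Q : scal (- d : C_AbsRing)%C
      (plus (scal (s1 * c : C_AbsRing)%C (U (U x))) (scal (s3 : C_AbsRing) x)) = zero).
    { rewrite (@scal_distr_l C_AbsRing K), !(@scal_assoc C_AbsRing K).
      etransitivity; [|exact H]. rewrite (@scal_zero_coef K _ (U (U (U x)))) by (unfold d; ring).
      rewrite (@scal_zero_coef K _ (U x)) by ring. rewrite (@plus_zero_l K), (@plus_zero_l K).
      unfold c, mult; simpl. f_equal; f_equal; ring. }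
    apply (@scal_C_eq_zero K) in Q. destruct Q as [Q|Q]; [|exact Q]. exfalso. apply Nd.
    replace d with (- - d)%C by ring. rewrite Q. ring. }
  assert (A2 : plus (scal (c : C_AbsRing)%C (U (U x))) (scal (s2 : C_AbsRing) x) = zero).
  (* The odd terms give this equation with [U] applied to it; injectivity of [U] removes it. *)
  { apply NNPP. intros N. apply (unitary_neq_0 hip U) in N; auto. apply N.
    rewrite (linear_plus U (proj1 hU)), !(linear_scal U (proj1 hU)).
    assert (Q : scal (g z * d' : C_AbsRing)%C
      (plus (scal (c : C_AbsRing)%C (U (U (U x)))) (scal (s2 : C_AbsRing) (U x))) = zero).
    { rewrite (@scal_distr_l C_AbsRing K), !(@scal_assoc C_AbsRing K).
      etransitivity; [|exact H']. rewrite (@scal_zero_coef K _ (U (U x))) by ring.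
      rewrite (@scal_zero_coef K _ x) by ring. rewrite !(@plus_zero_r K).
      unfold c, mult; simpl. f_equal; f_equal; unfold d'; ring. }
    apply (@scal_C_eq_zero K) in Q. destruct Q as [Q|Q]; [|exact Q]. exfalso.
    revert Q. apply Cmult_neq_0; auto. }
  assert (A3 : scal (s1 * s2 - s3 : C_AbsRing)%C x = zero).
  (* Subtracting [A1] from [s1] times [A2] eliminates [U^2 x]. *)
  { assert (A2' : scal (s1 : C_AbsRing) (plus (scal (c : C_AbsRing)%C (U (U x))) (scal (s2 : C_AbsRing) x)) = zero)
      by (rewrite A2; exact (@scal_zero_r C_Ring K s1)).
    rewrite (@scal_distr_l C_AbsRing K), !(@scal_assoc C_AbsRing K) in A2'.
    apply (@plus_reg_l K (plus (scal (s1 * c : C_AbsRing)%C (U (U x))) (scal (s3 : C_AbsRing) x))).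
    transitivity (zero : K).
    - etransitivity; [|exact A2']. rewrite <- (@plus_assoc K), <- (@scal_distr_r C_AbsRing K).
      f_equal. f_equal. unfold plus, mult; simpl. ring.
    - rewrite A1. symmetry. apply (@plus_zero_r K). }
  apply (@scal_C_eq_zero K) in A3. destruct A3 as [A3|]; [|contradiction].
  replace (s1 * s2)%C with (s1 * s2 - s3 + s3)%C by ring. rewrite A3. ring.
Qed.

(** The polynomial of [T] reduces to [t^3 - 1], so [T^3 = I]; each conclusion on [phi], [U] and [V]
    reads this identity on one simple test function. *)
Lemma order_three_case (x : K) : x <> zero ->
  (1 + l1 + l2 = 0)%C -> (l1 + l2 + l1 * l2 = 0)%C ->
  (forall z, Cmod z < 1 -> phi (phi (phi z)) = z) /\
  (l1 ^ 3 = RtoC 1 /\ l2 ^ 3 = RtoC 1)%C /\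
  (forall (z : C) (x : K), Cmod z < 1 ->
     scal (iter_branch g phi 3 z : C_AbsRing) (U (U (U x))) = x) /\
  (forall x, V (V (V x)) = x).
Proof.
  intros Nx S1 S2.
  assert (E12 : (l1 * l2 = 1)%C).
  { replace (l1 * l2)%C with ((l1 + l2 + l1 * l2) - (1 + l1 + l2) + 1)%C by ring. rewrite S1, S2. ring. }
  assert (C1 : (l1 * l1 * l1 = 1)%C).
  { replace (l1 * l1 * l1)%C with (l1 * l1 * (1 + l1 + l2) - l1 * (l1 + l2 + l1 * l2) + l1 * l2)%C by ring.
    rewrite S1, S2, E12. ring. }
  assert (C2 : (l2 * l2 * l2 = 1)%C).
  { replace (l2 * l2 * l2)%C with (l2 * l2 * (1 + l1 + l2) - l2 * (l1 + l2 + l1 * l2) + l1 * l2)%C by ring.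
    rewrite S1, S2, E12. ring. }
  assert (T3 : forall f, T (T (T f)) = f).
  { intros f. rewrite !(tri_comb_comp hP), C1, C2. apply (tri_comb_one hP). }
  assert (D3 : forall (y : K) z, Cmod z < 1 ->
    scal (g z * (g (phi z) * g (phi (phi z))) : C_AbsRing)%C (U (U (U y))) = y).
  (* A constant derivative [y] makes the composition with [phi] invisible. *)
  { intros y z Hz. destruct (Sp_cubic hp zero y 1 0 0 0) as [f [_ Hf]].
    pose proof (T3_hderiv f z Hz) as E. rewrite T3, !Hf in E by auto.
    assert (E1 : forall w, cubic 1 0 0 0 w = RtoC 1) by (intros w; unfold cubic; ring).
    rewrite !E1 in E. change (RtoC 1) with (one : C_AbsRing) in E.
    rewrite !(@scal_one C_AbsRing K) in E. now symmetry. }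
  split; [|split; [|split]].
  (* The derivative [w x] records the point of evaluation; comparison with [D3] gives
     [z x = phi^3(z) x]. *)
  - intros z Hz. destruct (Sp_cubic hp zero x 0 1 0 0) as [f [_ Hf]].
    pose proof (T3_hderiv f z Hz) as E. rewrite T3, !Hf in E by auto.
    assert (E1 : forall w, cubic 0 1 0 0 w = w) by (intros w; unfold cubic; ring).
    rewrite !E1, !(linear_scal U (proj1 hU)), (@scal_assoc C_AbsRing K) in E.
    assert (E' : scal (z - phi (phi (phi z)) : C_AbsRing)%C x = zero).
    { transitivity (minus (scal (z : C_AbsRing) x) (scal (phi (phi (phi z)) : C_AbsRing) x)).
      - unfold minus. etransitivity; [exact (@scal_distr_r C_Ring K z (- phi (phi (phi z)))%C x)|].
        f_equal. exact (@scal_opp_l C_Ring K (phi (phi (phi z))) x).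
      - rewrite E. rewrite <- (D3 x z Hz) at 2. rewrite (@scal_assoc C_AbsRing K).
        assert (Ec : forall a b : C_AbsRing, mult a b = mult b a) by exact Cmult_comm.
        rewrite (Ec (phi (phi (phi z)))). apply (@minus_eq_zero K). }
    apply (@scal_C_eq_zero K) in E'. destruct E' as [E'|]; [|contradiction].
    replace (phi (phi (phi z))) with (z - (z - phi (phi (phi z))))%C by ring. rewrite E'. ring.
  - split; [rewrite <- C1|rewrite <- C2]; simpl; ring.
  - intros z y Hz. etransitivity; [|exact (D3 y z Hz)]. f_equal. simpl. ring.
  (* The constant function [y] sees only [V]. *)
  - intros y. destruct (Sp_cubic hp y zero 0 0 0 0) as [f [Hf _]].
    rewrite <- Hf, <- !T_at_0, T3. reflexivity.
Qed.

Lemma component_eigen (f : Sp K hp) (mu z : C) : T f = scal (mu : C_AbsRing) f -> Cmod z < 1 ->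
  V (Sp_val f (RtoC 0)) = scal (mu : C_AbsRing) (Sp_val f (RtoC 0)) /\
  scal (g z : C_AbsRing) (U (hderiv (Sp_val f) (phi z))) = scal (mu : C_AbsRing) (hderiv (Sp_val f) z).
Proof.
  intros E Hz. rewrite <- T_at_0, <- T_hderiv, E by easy. split; [reflexivity|].
  exact (Sp_hderiv_scal mu f z Hz).
Qed.

(** * The case where [phi] is the identity *)

Section Identity.
Context (hid : forall z, Cmod z < 1 -> phi z = z).

Lemma weighted_isometry (z : C) : Cmod z < 1 -> forall u v : K,
  ip (scal (g z : C_AbsRing) (U u)) (scal (g z : C_AbsRing) (U v)) = ip u v.
Proof.
  intros Hz u v. rewrite (ip_scal _ hip), (ip_scal_r hip), (proj1 (proj2 hU)).
  transitivity (Cconj (g z) * g z * ip u v)%C; [ring|].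
  rewrite Cmod_1_conj by now apply (Cmod_identity_branch hg hid). ring.
Qed.

Lemma identity_component_eigen (f : Sp K hp) (mu z : C) : T f = scal (mu : C_AbsRing) f -> Cmod z < 1 ->
  V (Sp_val f (RtoC 0)) = scal (mu : C_AbsRing) (Sp_val f (RtoC 0)) /\
  scal (g z : C_AbsRing) (U (hderiv (Sp_val f) z)) = scal (mu : C_AbsRing) (hderiv (Sp_val f) z).
Proof.
  intros E Hz. pose proof (component_eigen f mu z E Hz) as H. now rewrite hid in H.
Qed.

(** The components of [f(0)] are eigenvectors of [V], those of [f'(z)] eigenvectors of [g(z) U], for
    [1], [l1], [l2]. By orthogonality [m1] and [m2] preserve the norm at each point, hence both
    summands of [Sp_norm]. *)
Lemma identity_norm (m1 m2 : C) (f : Sp K hp) : Cmod m1 = 1 -> Cmod m2 = 1 ->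
  norm (tri_comb P0 P1 P2 m1 m2 f) = norm f.
Proof.
  intros Hm1 Hm2. destruct (family_eigen hP l1 l2 f) as [E0 [E1 E2]].
  rewrite (family_sum hP f) at 2. rewrite tri_comb_lin3.
  change (Sp_norm K p (lin3 (P0 f) (P1 f) (P2 f) (RtoC 1) m1 m2) =
    Sp_norm K p (lin3 (P0 f) (P1 f) (P2 f) (RtoC 1) (RtoC 1) (RtoC 1))).
  unfold Sp_norm. f_equal.
  - rewrite !Sp_val_lin3.
    apply (isometry_spectral_norm hip V _ _ _ l1 l2); auto; [apply hV| | |].
    + apply (identity_component_eigen _ _ (RtoC 0) E0), disk_0.
    + apply (identity_component_eigen _ _ (RtoC 0) E1), disk_0.
    + apply (identity_component_eigen _ _ (RtoC 0) E2), disk_0.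
  - apply Hp_norm_ext_norm. intros z Hz. rewrite !Sp_hderiv_lin3 by easy.
    apply (isometry_spectral_norm hip (fun x => scal (g z : C_AbsRing) (U x)) _ _ _ l1 l2); auto.
    + now apply weighted_isometry.
    + now apply (identity_component_eigen _ _ z E0).
    + now apply (identity_component_eigen _ _ z E1).
    + now apply (identity_component_eigen _ _ z E2).
Qed.

Lemma identity_tricircular : tricircular P0 P1 P2.
Proof.
  split; [exact hP|]. intros m1 m2 Hm1 Hm2. split.
  - intros f h. rewrite (tri_comb_minus hP). now apply identity_norm.
  (* Inverting the scalars inverts the operator. *)
  - intros f. exists (tri_comb P0 P1 P2 (/ m1) (/ m2) f). rewrite (tri_comb_comp hP).
    assert (N : forall m, Cmod m = 1 -> m <> RtoC 0) by (intros m Hm ->; rewrite Cmod_0 in Hm; lra).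
    rewrite !Cinv_r by auto. apply (tri_comb_one hP).
Qed.

Lemma identity_eigenvalue (f : Sp K hp) (mu z : C) : f <> zero -> T f = scal (mu : C_AbsRing) f ->
  Cmod z < 1 ->
  eigenvalue (fun x => scal (g z : C_AbsRing) (U x)) mu \/ eigenvalue V mu.
Proof.
  intros Nf E Hz. destruct (Sp_neq_zero f Nf) as [N|[w [Hw N]]].
  - right. exists (Sp_val f (RtoC 0)). split; [exact N|]. now apply (identity_component_eigen f mu z).
  - left. exists (hderiv (Sp_val f) w). split; [exact N|].
    (* The eigenvector lives at [w]; constancy of [g] transfers it to the prescribed [z]. *)
    rewrite (identity_branch_constant hg hid z Hz), <- (identity_branch_constant hg hid w Hw).
    now apply (identity_component_eigen f mu w).
Qed.

(** Every vector of [K] is a value at [0] or a derivative at [z] of some test function, hence a sum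
    of eigenvectors for [1], [l1], [l2]. Conversely each projection is nonzero and supplies an
    eigenvector of [T]. *)
Lemma identity_spectrum (z mu : C) : Cmod z < 1 ->
  (eigenvalue (fun x => scal (g z : C_AbsRing) (U x)) mu \/ eigenvalue V mu) <->
  (mu = RtoC 1 \/ mu = l1 \/ mu = l2).
Proof.
  intros Hz. split.
  - intros H.
    (* One argument for both operators: [ev] is the derivative at [z] when [W] is [g(z) U], and the
       value at [0] when [W] is [V]. *)
    assert (Q : forall (W : K -> K) (ev : Sp K hp -> K) (x : K),
      (forall u v, ip (W u) (W v) = ip u v) ->
      (forall (f : Sp K hp) nu, T f = scal (nu : C_AbsRing) f -> W (ev f) = scal (nu : C_AbsRing) (ev f)) ->
      (forall f0 f1 f2 : Sp K hp, ev (lin3 f0 f1 f2 (RtoC 1) (RtoC 1) (RtoC 1)) =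
        lin3 (ev f0) (ev f1) (ev f2) (RtoC 1) (RtoC 1) (RtoC 1)) ->
      (exists f, ev f = x) ->
      x <> zero -> W x = scal (mu : C_AbsRing) x -> mu = RtoC 1 \/ mu = l1 \/ mu = l2).
    { intros W ev x HW Hev Hlin [f Hf] Nx Ex. destruct (family_eigen hP l1 l2 f) as [E0 [E1 E2]].
      apply (isometry_spectrum hip W x (ev (P0 f)) (ev (P1 f)) (ev (P2 f))); auto.
      rewrite <- Hf. rewrite (family_sum hP f) at 1. rewrite Hlin. apply (lin3_one (X := K)). }
    destruct H as [[x [Nx Ex]]|[x [Nx Ex]]].
    + apply (Q (fun x => scal (g z : C_AbsRing) (U x)) (fun f => hderiv (Sp_val f) z) x); auto.
      * now apply weighted_isometry.
      * intros f nu E. now apply (identity_component_eigen f nu z).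
      * intros f0 f1 f2. now apply Sp_hderiv_lin3.
      * destruct (Sp_cubic hp zero x 1 0 0 0) as [f [_ Hf]]. exists f. rewrite Hf by easy.
        replace (cubic 1 0 0 0 z) with (RtoC 1) by (unfold cubic; ring). exact (@scal_one C_Ring K x).
    + apply (Q V (fun f => Sp_val f (RtoC 0)) x); auto.
      * apply hV.
      * intros f nu E. now apply (identity_component_eigen f nu z).
      * destruct (Sp_cubic hp x zero 0 0 0 0) as [f [Hf _]]. now exists f.
  - destruct hP as [_ [[[f0 N0] [[f1 N1] [f2 N2]]] _]].
    intros [->|[->| ->]].
    + apply (identity_eigenvalue (P0 f0)); auto. apply (family_eigen hP l1 l2 f0).
    + apply (identity_eigenvalue (P1 f1)); auto. apply (family_eigen hP l1 l2 f1).
    + apply (identity_eigenvalue (P2 f2)); auto. apply (family_eigen hP l1 l2 f2).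
Qed.

End Identity.

End Main.

(** Changing the branch [g] by a constant factor changes [U] by the inverse factor without changing
    [T]. The conclusions on [U] are therefore stated for [g(z) U] and for the weight
    [iter_branch g phi 3 z] times [U^3], which [T] determines. *)
Theorem theorem3p1
  (K : CompleteNormedModule C_AbsRing) (ip : K -> K -> C)
  (hip : is_inner_product ip) (hsep : separable (K := K))
  (p : R) (hp : 1 <= p) (hp2 : p <> 2)
  (P0 P1 P2 : Sp K hp -> Sp K hp)
  (hC : generalized_tricircular P0 P1 P2)
  (l1 l2 : C)
  (hl1 : Cmod l1 = 1) (hl2 : Cmod l2 = 1)
  (hl1' : l1 <> RtoC 1) (hl2' : l2 <> RtoC 1) (hl12 : l1 <> l2)
  (hT : surjective_isometry (tri_comb P0 P1 P2 l1 l2))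
  (U V : K -> K) (hU : unitary ip U) (hV : unitary ip V)
  (phi : C -> C) (hphi : disk_automorphism phi)
  (g : C -> C) (hg : power_branch p phi g)
  (hform : forall (f : Sp K hp) (z : C), Cmod z < 1 ->
     Sp_val (tri_comb P0 P1 P2 l1 l2 f) z =
     plus (V (Sp_val f (RtoC 0)))
       (U (integral_0
            (fun xi : C => scal (g xi : C_AbsRing) (hderiv (Sp_val f) (phi xi))) z))) :
  ( (forall z, Cmod z < 1 -> phi z = z) /\
    tricircular P0 P1 P2 /\
    (forall (z mu : C), Cmod z < 1 ->
       (eigenvalue (fun x => scal (g z : C_AbsRing) (U x)) mu \/
        eigenvalue V mu) <->
       (mu = RtoC 1 \/ mu = l1 \/ mu = l2)) )
  \/
  ( ~ (forall z, Cmod z < 1 -> phi z = z) /\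
    (forall z, Cmod z < 1 -> phi (phi z) = z) /\
    (bicircular_projection P0 \/ bicircular_projection P1 \/ bicircular_projection P2) )
  \/
  ( ~ (forall z, Cmod z < 1 -> phi z = z) /\
    ~ (forall z, Cmod z < 1 -> phi (phi z) = z) /\
    (forall z, Cmod z < 1 -> phi (phi (phi z)) = z) /\
    (l1 ^ 3 = RtoC 1 /\ l2 ^ 3 = RtoC 1)%C /\
    (forall (z : C) (x : K), Cmod z < 1 ->
       scal (iter_branch g phi 3 z : C_AbsRing) (U (U (U x))) = x) /\
    (forall x, V (V (V x)) = x) ).
Proof.
  destruct hC as [hP _].
  assert (Nx : exists x : K, x <> zero).
  (* A nonzero projection forces [K] to contain a nonzero vector, on which the test functions are
     built. *)
  { destruct hP as [_ [[[f Nf] _] _]]. destruct (Sp_neq_zero (P0 f) Nf) as [N|[w [_ N]]]; eauto. }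
  destruct Nx as [x Nx].
  destruct (classic (exists z, Cmod z < 1 /\ z <> phi z /\ z <> phi (phi z))) as [[z [Hz [N1 N2]]]|HN].
  - right; right.
    destruct (distinct_orbit hip hP hl1 hl2 hU hphi hg hform x z Nx Hz N1 N2) as [S1 S2].
    destruct (order_three_case hP hU hphi hg hform x Nx S1 S2) as [H1 [H2 [H3 H4]]].
    repeat split; try easy.
    + intros H. apply N1. now rewrite H.
    + intros H. apply N2. now rewrite H.
  (* A point moved by [phi^2] is also moved by [phi], and so would be a point of the excluded
     kind. *)
  - assert (H2 : forall z, Cmod z < 1 -> phi (phi z) = z).
    { intros z Hz. apply NNPP. intros N. apply HN. exists z. repeat split; [easy| |now apply not_eq_sym].
      intros E. apply N. now rewrite <- !E. }
    destruct (classic (forall z, Cmod z < 1 -> phi z = z)) as [hid|N].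
    + left. split; [exact hid|split].
      * exact (identity_tricircular hip hP hl1 hl2 hl1' hl2' hl12 hU hV hphi hg hform hid).
      * intros z mu Hz. exact (identity_spectrum hip hP hl1 hl2 hU hV hphi hg hform hid z mu Hz).
    + right; left. split; [exact N|split; [exact H2|]].
      apply not_all_ex_not in N. destruct N as [z N]. apply imply_to_and in N. destruct N as [Hz N].
      apply (bicircular_of_square hP l1 l2); auto.
      apply (involutive_orbit hip hP hU hphi hg hform x z); auto.
Qed.
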